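(* Let $\mathcal{N}(t)$, $t>0$, be a classical nonlinear pure birth process with pairwise distinct birth rates $\lambda_k>0$, $k\ge1$, and $\mathcal{N}(0)=1$, where $\sum_k1/\lambda_k=\infty$. Let $T_t$ be the first-passage time at level $t$ of a standard Brownian motion independent of $\mathcal{N}$. The process $\hat{\mathcal{N}}(t)=\mathcal{N}(T_t)$, $t>0$, has state probabilities $\hat p_k(t)=\Pr\{\mathcal{N}(T_t)=k\}$ given by $$\hat p_k(t)=\begin{cases}\displaystyle\prod_{j=1}^{k-1}\lambda_j\sum_{m=1}^k\frac{e^{-t\sqrt{2\lambda_m}}}{\prod_{l=1,l\neq m}^k(\lambda_l-\lambda_m)},&k>1,\ t>0,\\[2mm] e^{-t\sqrt{2\lambda_1}},&k=1,\ t>0,\end{cases}$$ and mean value $$\mathbb{E}\,\mathcal{N}(T_t)=1+\sum_{k=1}^\infty\left(1-\sum_{m=1}^k\ \prod_{l=1,l\neq m}^k\frac{\lambda_l}{\lambda_l-\lambda_m}\,e^{-t\sqrt{2\lambda_m}}\right).$$ Moreover, under the condition $\sum_k1/\lambda_k=\infty$ this distribution is non-exploding, i.e. $\sum_{k\ge1}\hat p_k(t)=1$ for all $t>0$.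
   Context: The nonlinear pure birth process $\mathcal{N}(t)$ with rates $(\lambda_k)_{k\ge1}$ is the continuous-time Markov chain on $\{1,2,\dots\}$ started at $1$ which from state $k$ jumps only to $k+1$, at rate $\lambda_k$. For a standard Brownian motion $B$, $T_t=\inf\{s:B(s)=t\}$, with density $q(t,s)=t\,e^{-t^2/(2s)}/\sqrt{2\pi s^3}$, $s>0$. Empty products equal $1$. Mean values and the corresponding series are allowed to equal $+\infty$. *)

(* Defs.v *)
From HB Require Import structures.
From mathcomp Require Import all_boot all_order all_algebra finmap.
From mathcomp Require Import all_classical all_reals all_analysis.
From mathcomp Require Import measurable_realfun.

Set Implicit Arguments.
Unset Strict Implicit.
Unset Printing Implicit Defensive.

Import Order.TTheory GRing.Theory Num.Theory.
Import numFieldNormedType.Exports.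

Local Open Scope classical_set_scope.
Local Open Scope ring_scope.

Section processes.
Context {R : realType} {d : measure_display} {T : measurableType d}.
Variable P : probability T R.

Definition mutually_independent {I : choiceType} {d' : measure_display}
    {U : measurableType d'} (X : I -> T -> U) : Prop :=
  forall (J : {fset I}) (A : I -> set U), (forall i, measurable (A i)) ->
    P (\bigcap_(i in [set` J]) (X i @^-1` A i)) =
    (\prod_(i <- J) P (X i @^-1` A i))%E.

(* Random processes have time set [0, +oo[; their values at negative indices
   are irrelevant. *)
Definition process_sigma {d' : measure_display} {U : measurableType d'}
    (X : R -> T -> U) : set (set T) :=
  <<s [set X s @^-1` A | s in [set s : R | 0 <= s] & A in measurable] >>.

Definition independent_processes {d1 d2 : measure_display}
    {U1 : measurableType d1} {U2 : measurableType d2}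
    (X : R -> T -> U1) (Y : R -> T -> U2) : Prop :=
  forall A B : set T, process_sigma X A -> process_sigma Y B ->
    P (A `&` B) = (P A * P B)%E.

(* The second argument of [normal_prob] is the standard deviation. *)
Definition standard_brownian_motion (B : R -> {RV P >-> R}) : Prop :=
  [/\ {ae P, forall w, B 0 w = 0},
      forall w, {within `[0, +oo[, continuous (fun s : R => B s w)},
      forall u : nat -> R, 0 <= u 0%N -> nondecreasing_seq u ->
        mutually_independent (fun i w => B (u i.+1) w - B (u i) w) &
      forall (r s : R) (A : set R), 0 <= r -> r < s -> measurable A ->
        P ((fun w => B s w - B r w) @^-1` A) =
        normal_prob 0 (Num.sqrt (s - r)) A].

(* Equal to [+oo] when the level is never reached. *)
Definition first_passage_time (B : R -> T -> R) (t : R) (w : T) : \bar R :=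
  ereal_inf [set s%:E | s in [set s : R | 0 <= s /\ B s w = t]].

(* Jump chain / holding time description of the minimal chain: [W k] is the
   time spent in state [k] ([W 0] is not used), so that state [k] is occupied
   on the interval [W 1 + ... + W (k - 1), W 1 + ... + W k[.  States are
   extended reals so that the value [+oo] can serve as the cemetery state after
   a possible explosion, which this definition does not exclude. *)
Definition pure_birth_process (lambda : nat -> R) (N : R -> T -> \bar R) :
    Prop :=
  exists W : nat -> {RV P >-> R},
  [/\ forall (k : nat) (A : set R), (0 < k)%N -> measurable A ->
        distribution P (W k) A = exponential_prob (lambda k) A,
      mutually_independent (fun k => W k.+1 : T -> R),
      forall (k : nat) w, (0 < k)%N -> 0 < W k w,
      forall (k : nat) (s : R) w, (0 < k)%N ->
        \sum_(1 <= j < k) W j w <= s < \sum_(1 <= j < k.+1) W j w ->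
        N s w = (k%:R)%:E &
      forall (s : R) w, (forall k : nat, \sum_(1 <= j < k) W j w <= s) ->
        N s w = +oo%E].

End processes.

Arguments standard_brownian_motion {R d T} P B.

(* At an infinite random time the process gets the value [+oo], the limit of a
   nondecreasing unbounded path. *)
Definition time_changed {R : realType} {T : Type}
    (N : R -> T -> \bar R) (tau : T -> \bar R) (w : T) : \bar R :=
  if tau w is s%:E then N s w else +oo%E.

(* Main.v *)
Require Import Defs.
From HB Require Import structures.
From mathcomp Require Import all_boot all_order all_algebra finmap.
From mathcomp Require Import all_classical all_reals all_analysis.
From mathcomp Require Import measurable_realfun ring lra.

(** The chain sits in state [k + 1] exactly while [S k <= s < S k.+1], where [S k]
is the sum of the first [k] holding times.  For [l] distinct from the rates,
[h k l s := E (exp (- l (s - S k)); S k <= s)] satisfies, by independence of the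
next holding time (of rate [mu]), [h k.+1 l = mu / (l - mu) * (h k mu - h k l)];
this recursion is solved by partial fractions, and [h k mu s] is the probability
of state [k + 1] at time [s].  Taking [l = -1] gives
[P (S k <= s) <= exp s * \prod lambda_j / (1 + lambda_j)], which tends to [0]
when the series of the [1 / lambda_j] diverges.

The passage time [T] of the level [t] is independent of the [S k], so the
probabilities [P (S k <= T < S k.+1)] are obtained by integrating the previous
formula, that is, by replacing [exp (- lambda_m s)] by the Laplace transform of
[T].  The latter equals [exp (- t sqrt (2 l))] by optional stopping of
[exp (th B_s - th^2 s / 2)], [th^2 = 2 l]: stop at the first point of a grid where
the path is above a level, so that only finitely many independent increments are
involved, and refine the grid.  Letting [l] tend to [0] shows [T] is finite almost
surely.  Finally [N (T)] is the sum over [k] of the indicators of [S k <= T],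
whence its mean, and [P (S k <= T)] tends to [0], whence the absence of
explosion. *)

Set Implicit Arguments.
Unset Strict Implicit.
Unset Printing Implicit Defensive.

Import Order.TTheory GRing.Theory Num.Theory.
Import numFieldNormedType.Exports.

Local Open Scope classical_set_scope.
Local Open Scope ring_scope.

(** * Independence of the past *)

Section independence.
Context {R : realType} {d : measure_display} {T : measurableType d}.
Variable P : probability T R.
Local Open Scope ereal_scope.

(** The joint law of [(X, Y)] and the product of the marginal laws agree on rectangles, hence
    everywhere; Tonelli's theorem does the rest. *)
Lemma ge0_integral_indep d1 d2 (U1 : measurableType d1) (U2 : measurableType d2)
    (X : T -> U1) (Y : T -> U2) (phi : U1 * U2 -> \bar R) :
    measurable_fun setT X -> measurable_fun setT Y ->
    (forall A B, measurable A -> measurable B ->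
      P ((X @^-1` A) `&` (Y @^-1` B)) = P (X @^-1` A) * P (Y @^-1` B)) ->
    measurable_fun setT phi -> (forall z, 0 <= phi z) ->
  \int[P]_w phi (X w, Y w) = \int[P]_w' \int[P]_w phi (X w', Y w).
Proof.
move=> mX mY XY mphi phi0.
pose X' : {mfun T >-> U1} := HB.pack X (isMeasurableFun.Build _ _ _ _ _ mX).
pose Y' : {mfun T >-> U2} := HB.pack Y (isMeasurableFun.Build _ _ _ _ _ mY).
have mXY : measurable_fun setT (fun w => (X w, Y w)) by apply/measurable_fun_pair.
pose Z : {mfun T >-> (U1 * U2)%type} :=
  HB.pack (fun w => (X w, Y w)) (isMeasurableFun.Build _ _ _ _ _ mXY).
have prodE A : measurable A ->
    (distribution P X' \x distribution P Y') A = distribution P Z A.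
  move=> mA; exact: product_measure_unique.
transitivity (\int[distribution P Z]_z phi z).
  by rewrite ge0_integral_distribution.
transitivity (\int[distribution P X' \x distribution P Y']_z phi z).
  apply: eq_measure_integral => A mA _; exact/esym/prodE.
rewrite fubini_tonelli1//.
rewrite ge0_integral_distribution//.
- apply: eq_integral => w _ /=; rewrite /fubini_F ge0_integral_distribution//.
  exact: measurableT_comp.
- exact: measurable_fun_fubini_tonelli_F.
- by move=> x; apply: integral_ge0.
Qed.

(** A pi-system generating the sigma-algebra of the first [n] variables; on its rectangles mutual
    independence applies directly. *)
Definition past_cylinders (X : nat -> T -> R) (n : nat) : set (set T) :=
  [set C | exists2 A : nat -> set R, (forall i, measurable (A i)) &
    C = \bigcap_(i in `I_n) (X i @^-1` A i)].

Lemma past_cylinders_setI X n : setI_closed (past_cylinders X n).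
Proof.
move=> _ _ [A mA ->] [B mB ->]; exists (fun i => A i `&` B i).
  by move=> i; exact: measurableI.
by rewrite -bigcapI.
Qed.

Lemma past_cylinders_measurable X n : (forall i, measurable_fun setT (X i)) ->
  past_cylinders X n `<=` measurable.
Proof.
move=> mX _ [A mA ->]; apply: fin_bigcap_measurable => // i _.
by rewrite -[X in measurable X]setTI; exact: mX.
Qed.

Lemma measurable_fun_past X n i : (i < n)%N ->
  measurable_fun setT (X i : g_sigma_algebraType (past_cylinders X n) -> R).
Proof.
move=> ltin _ A mA; rewrite setTI; apply: sub_sigma_algebra.
exists (fun j => if j == i then A else setT); first by move=> j; case: ifP.
apply/seteqP; split=> [w /= Aw j _|w /(_ i ltin)/=]; last by rewrite eqxx.
by case: eqP => [->|_].
Qed.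

(** As functions of [C], both sides are finite measures, [mrestr] and [mscale] of [P]; they agree on
    the pi-system of past cylinders, hence on the sigma-algebra it generates. *)
Lemma mutually_independent_past (X : nat -> T -> R) n C B :
    (forall i, measurable_fun setT (X i)) ->
    mutually_independent P X -> <<s past_cylinders X n >> C -> measurable B ->
  P (C `&` (X n @^-1` B)) = P C * P (X n @^-1` B).
Proof.
move=> mX iX sC mB.
have mXB : measurable (X n @^-1` B) by rewrite -[X in measurable X]setTI; exact: mX.
have PB : P (X n @^-1` B) \is a fin_num by exact: fin_num_measure.
pose r : {nonneg R} := NngNum (fine_ge0 (measure_ge0 P (X n @^-1` B))).
rewrite muleC -[X in _ = X * _]fineK// -[RHS]/(mscale r P C).
rewrite -[LHS]/(mrestr P mXB C).
apply: (@g_sigma_algebra_measure_unique _ _ _ (past_cylinders X n) _ (fun=> setT)) => //.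
- exact: past_cylinders_measurable.
- by move=> _; exists (fun=> setT) => //; apply/seteqP; split.
- by rewrite bigcup_const//; exists 0%N.
- exact: past_cylinders_setI.
- move=> _ [A mA ->]; rewrite /= /mscale /mrestr/= fineK//.
  (* Mutual independence is applied to the first [n] and to the first [n.+1] indices with the same
     sets [A']; the two products differ by the factor of [B]. *)
  pose A' i := if (i < n)%N then A i else if i == n then B else setT.
  have mA' i : measurable (A' i) by rewrite /A'; case: ifP => // _; case: ifP.
  have A'n : A' n = B by rewrite /A' ltnn eqxx.
  pose J m := [fset i in iota 0 m]%fset.
  have JE m : [set` J m] = `I_m.
    by apply/seteqP; split=> i; rewrite /= !inE mem_iota.
  have prodJ m : \prod_(i <- J m) P (X i @^-1` A' i)
                = \prod_(i < m) P (X i @^-1` A' i).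
    rewrite -(big_mkord xpredT (fun i => P (X i @^-1` A' i))).
    apply: perm_big; apply: uniq_perm; [exact: fset_uniq|exact: iota_uniq|].
    by move=> i; rewrite !inE /index_iota subn0.
  have := iX (J n.+1) _ mA'; have := iX (J n) _ mA'.
  rewrite !prodJ !JE big_ord_recr/= => <-; rewrite A'n => Pn.
  have -> : \bigcap_(i in `I_n) (X i @^-1` A i) = \bigcap_(i in `I_n) (X i @^-1` A' i).
    by apply: eq_bigcapr => i /= ltin; rewrite /A' ltin.
  by rewrite [RHS]muleC -Pn; congr (P _); rewrite IIS bigcap_setU bigcap_set1 A'n.
- move=> _; rewrite /= /mrestr.
  apply: le_lt_trans (probability_le1 _ _) (ltry _) => //.
  exact: measurableI.
Qed.

(** Conditioning on the past: being a function of the first [n] variables is expressed as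
    measurability of [Y] for the sigma-algebra of the cylinders. *)
Lemma ge0_integral_past (X : nat -> T -> R) n d1 (U : measurableType d1)
    (Y : T -> U) (phi : U * R -> \bar R) :
    (forall i, measurable_fun setT (X i)) -> mutually_independent P X ->
    measurable_fun setT (Y : g_sigma_algebraType (past_cylinders X n) -> U) ->
    measurable_fun setT phi -> (forall z, 0 <= phi z) ->
  \int[P]_w phi (Y w, X n w) = \int[P]_w' \int[P]_w phi (Y w', X n w).
Proof.
move=> mX iX mY mphi phi0; apply: ge0_integral_indep => //.
- move=> _ A mA; have := mY measurableT A mA.
  have := @past_cylinders_measurable X n mX.
  by move=> /(smallest_sub (@sigma_algebra_measurable _ T)); exact.
- move=> A B mA mB; apply: mutually_independent_past => //.
  by have := mY measurableT A mA; rewrite setTI.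
Qed.

End independence.

(** * Densities and exponential integrals *)

Section density.
Context {R : realType} {d : measure_display} {T : measurableType d}.
Variables (mu nu : {measure set T -> \bar R}) (g : T -> R).
Hypotheses (mg : measurable_fun setT g) (g0 : forall x, 0 <= g x)
  (nuE : forall A, measurable A -> nu A = (\int[mu]_(x in A) (g x)%:E)%E).
Import HBNNSimple.
Local Open Scope ereal_scope.

Let integral_density_nnsfun (f : {nnsfun T >-> R}) :
  \int[nu]_x (f x)%:E = \int[mu]_x ((f x)%:E * (g x)%:E).
Proof.
under [LHS]eq_integral do rewrite fimfunE -fsumEFin//.
rewrite [LHS]ge0_integral_fsum//; last 2 first.
  - by move=> r; exact/measurable_EFinP/measurableT_comp.
  - by move=> n x _; rewrite EFinM nnfun_muleindic_ge0.
under [RHS]eq_integral.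
  move=> x xD; rewrite fimfunE -fsumEFin// muleC ge0_mule_fsumr; last first.
    by move=> r; rewrite EFinM nnfun_muleindic_ge0.
  over.
rewrite [RHS]ge0_integral_fsum//; last 2 first.
  - move=> r; apply: emeasurable_funM; first exact/measurable_EFinP.
    by apply/measurable_EFinP; do 2 apply/measurableT_comp => //.
  - move=> n x _; rewrite EFinM mule_ge0//; last by rewrite nnfun_muleindic_ge0.
    by rewrite lee_fin.
apply: eq_fsbigr => r _.
rewrite !integralZl_indic_nnsfun//= integral_indic// setIT nuE//.
have [r0|r0] := leP 0%R r; last first.
  rewrite preimage_nnfun0// integral_set0 mule0; apply/esym/integral0_eq => x _.
  by rewrite indicE in_set0 mulr0 mule0.
rewrite integral_mkcond -ge0_integralZl//; last 2 first.
- by apply/(measurable_restrictT _ _).1 => //; exact/measurable_EFinP/measurable_funTS.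
- by move=> x _; rewrite erestrict_ge0// => y _; rewrite lee_fin.
apply: eq_integral => x _; rewrite patchE indicE; case: ifPn => _.
  by rewrite mulr1 muleC.
by rewrite mulr0 !mule0.
Qed.

(** The case of simple functions passes to the limit by monotone convergence on both sides. *)
Lemma ge0_integral_density (f : T -> \bar R) :
  measurable_fun setT f -> (forall x, 0 <= f x) ->
  \int[nu]_x f x = \int[mu]_x (f x * (g x)%:E).
Proof.
move=> mf f0.
pose f_ := nnsfun_approx measurableT mf.
transitivity (limn (fun n => \int[nu]_x (f_ n x)%:E)).
  rewrite -monotone_convergence//=.
  - apply: eq_integral => ? /[!inE] xD; apply/esym/cvg_lim => //=.
    exact: cvg_nnsfun_approx.
  - by move=> n; exact/measurable_EFinP/measurable_funTS.
  - by move=> n ? _; rewrite lee_fin.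
  - by move=> ? _ ? ? mn; rewrite lee_fin; exact/lefP/nd_nnsfun_approx.
under eq_fun do rewrite integral_density_nnsfun.
rewrite -monotone_convergence//=.
- apply: eq_integral => x _; apply/cvg_lim => //.
  by apply: cvgeZr => //; exact: cvg_nnsfun_approx.
- move=> n; apply: emeasurable_funM; last exact/measurable_EFinP.
  exact/measurable_EFinP/measurable_funTS.
- by move=> n x _; rewrite mule_ge0// lee_fin.
- move=> x _ m n mn; apply: lee_wpmul2r; rewrite lee_fin//.
  exact/lefP/nd_nnsfun_approx.
Qed.

End density.

Section exponential_integral.
Context {R : realType} {d : measure_display} {T : measurableType d}.
Context {P : probability T R} (W : {RV P >-> R}) (m : R).
Hypothesis m0 : 0 < m.
Hypothesis distW : forall A, measurable A ->
  distribution P W A = exponential_prob m A.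

Lemma ge0_integral_exponential (f : R -> \bar R) :
  measurable_fun setT f -> (forall x, 0 <= f x)%E ->
  (\int[P]_w f (W w) =
   \int[lebesgue_measure]_y (f y * (exponential_pdf m y)%:E))%E.
Proof.
move=> mf f0.
have mW : measurable_fun setT (W : T -> measurableTypeR R) := measurable_funP W.
transitivity (\int[pushforward P (W : T -> measurableTypeR R)]_y f y)%E.
  by rewrite (ge0_integral_pushforward mW).
transitivity (\int[exponential_prob m]_y f y)%E.
  by apply: eq_measure_integral => A mA _; exact: distW.
apply: (@ge0_integral_density _ _ _ lebesgue_measure (exponential_prob m)) => //.
- exact: measurable_exponential_pdf.
- by move=> x; exact/exponential_pdf_ge0/ltW.
Qed.

(** Only holding times in [[0, r]] contribute, and there the integrand times the density is a single
    exponential in [y], of rate [l - m], with an explicit antiderivative because [l != m]. *)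
Lemma integral_exponential_discount (l r : R) : l != m -> 0 <= r ->
  (\int[P]_w (expR (- l * (r - W w)) * \1_`]-oo, r] (W w))%:E =
   (m / (l - m) * (expR (- m * r) - expR (- l * r)))%:E)%E.
Proof.
move=> lm r0.
have lm0 : l - m != 0 by rewrite subr_eq0.
rewrite (ge0_integral_exponential
  (f := fun y => (expR (- l * (r - y)) * \1_`]-oo, r] y)%:E)); last 2 first.
- apply/measurable_EFinP/measurable_funM => //.
  apply: measurableT_comp => //; apply: measurable_funM => //.
  exact: measurable_funB.
- by move=> y; rewrite lee_fin mulr_ge0 ?expR_ge0.
pose f y := m * expR (- m * y) * expR (- l * (r - y)).
pose F y := m / (l - m) * expR (- l * r + (l - m) * y).
transitivity (\int[lebesgue_measure]_(y in `[0%R, r]) (f y)%:E)%E.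
  rewrite [RHS]integral_mkcond/=; apply: eq_integral => y _.
  rewrite patchE -EFinM indicE mem_setE/= in_itv/=.
  have [y0|y0] := leP 0 y; last first.
    by rewrite lt0_exponential_pdf// mulr0 mem_setE in_itv/= leNgt y0.
  rewrite mem_setE in_itv/= y0/=; case: ifP => _.
    by rewrite mulr1 exponential_pdfE//= /f mulrC.
  by rewrite mulr0 mul0r.
(* The fundamental theorem of calculus is applied on a nondegenerate interval, so [r = 0] is settled
   first. *)
move: r0; rewrite le_eqVlt => /predU1P[<-|r0].
  by rewrite set_itv1 integral_set1// !mulr0 subrr mulr0.
have dF (x : R) : is_derive x 1 F (f x).
  have dA : is_derive x 1 (fun y : R => - l * r + (l - m) * y) (l - m).
    by apply: is_derive_eq; rewrite add0r mul1r /GRing.scale/= mulr1.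
  have := is_deriveZ (m / (l - m)) (is_derive1_comp (f := expR) _ dA).
  move=> /(_ _ (is_derive_expR _)); congr (is_derive _ _ _ _).
  rewrite /F /f /GRing.scale/= -[RHS]mulrA -expRD.
  by rewrite (_ : - m * x + _ = - l * r + (l - m) * x); [field|ring].
have cF : continuous F.
  by move=> x; apply/differentiable_continuous/derivable1_diffP; have [] := dF x.
rewrite (@continuous_FTC2 _ f F)//.
- rewrite -EFinB -mulrBr; congr (_ * (expR _ - expR _))%:E; ring.
- apply: continuous_subspaceT => x.
  (* Continuity of [f] is inherited from [F], since [f] is proportional to its own
     antiderivative. *)
  have -> : f = (fun y => (l - m) * F y).
    apply/funext => y; rewrite /f /F -mulrA -expRD mulrA; congr (_ * expR _); last by ring.
    by rewrite mulrCA divff// mulr1.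
  by apply: cvgM; [exact: cvg_cst|exact: cF].
- split=> [x _||].
  + by have [] := dF x.
  + exact/cvg_at_right_filter/cF.
  + exact/cvg_at_left_filter/cF.
- by move=> x _; rewrite derive1E; have [_ ->] := dF x.
Qed.
End exponential_integral.

Section exponential_tail.
Context {R : realType} {d : measure_display} {T : measurableType d}.
Context {P : probability T R} (W : {RV P >-> R}) (m : R).
Hypothesis distW : forall A, measurable A ->
  distribution P W A = exponential_prob m A.

Lemma exponential_tail (r : R) : (forall w, 0 < W w) -> 0 <= r ->
  P [set w | r < W w] = (expR (- m * r))%:E.
Proof.
move=> W0 r0.
have -> : [set w | r < W w] = ~` (W @^-1` `[0, r]).
  apply/seteqP; split=> w /=; rewrite in_itv/= (ltW (W0 w))/= ltNge.
    by move/negP.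
  by move=> H; apply/negP.
rewrite probability_setC; last exact: measurable_funPTI.
rewrite [P _](_ : _ = exponential_prob m `[0, r]); last exact: distW.
move: r0; rewrite le_eqVlt => /predU1P[<-|r0]; last first.
  rewrite exponential_prob_itv0c//.
  by rewrite -[LHS]/((1 - (1 - expR (- m * r)))%:E) subKr.
by rewrite /exponential_prob set_itv1 integral_set1 mulr0 expR0 sube0.
Qed.

End exponential_tail.

(** * Partial fractions *)

Section discount_formula.
Context {R : realType} (lam : nat -> R).
Hypothesis lam_inj : forall j k : nat, (0 < j)%N -> (0 < k)%N -> j <> k ->
  lam j <> lam k.

Let lam_neq j k : (0 < j)%N -> (0 < k)%N -> j != k -> lam j - lam k != 0.
Proof. by move=> j0 k0 /eqP jk; rewrite subr_eq0; apply/eqP/lam_inj. Qed.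

(* Closed form of [h k l s] in the notation of the header; [l = lam k.+1] gives
   the probability of state [k.+1]. *)
Definition birth_discount (k : nat) (l s : R) : R :=
  (\prod_(1 <= j < k.+1) lam j) *
  (expR (- l * s) / (\prod_(1 <= j < k.+1) (lam j - l)) +
   \sum_(1 <= m < k.+1) expR (- lam m * s) /
     ((l - lam m) * \prod_(1 <= j < k.+1 | j != m) (lam j - lam m))).

Lemma prod_neqS k m (F : nat -> R) : (0 < m < k.+1)%N ->
  \prod_(1 <= j < k.+2 | j != m) F j =
  (\prod_(1 <= j < k.+1 | j != m) F j) * F k.+1.
Proof.
move=> /andP[m0 mk]; rewrite big_mkcond big_nat_recr//= -big_mkcond/=.
by rewrite gt_eqF.
Qed.

Lemma prod_neq_last k (F : nat -> R) :
  \prod_(1 <= j < k.+2 | j != k.+1) F j = \prod_(1 <= j < k.+1) F j.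
Proof.
rewrite big_mkcond big_nat_recr//= eqxx mulr1 big_nat_cond [RHS]big_nat_cond.
by apply: eq_bigr => j; rewrite andbT => /andP[_ jk]; rewrite ltn_eqF.
Qed.

(** Writing [a] for [lam k.+1] and [x] for [lam m], the terms of index [m] match by the identity [1
    / ((l - x) (a - x)) = (1 / (a - x) - 1 / (l - x)) / (l - a)]. The separate term of
    [birth_discount k (lam k.+1)] becomes the new last summand. *)
Lemma birth_discountS (k : nat) (l s : R) :
    (forall j, (0 < j < k.+2)%N -> l != lam j) ->
  birth_discount k.+1 l s = lam k.+1 / (l - lam k.+1) *
    (birth_discount k (lam k.+1) s - birth_discount k l s).
Proof.
move=> lneq; have lk : l - lam k.+1 != 0 by rewrite subr_eq0 lneq// leqnn.
have lk' : lam k.+1 - l != 0 by rewrite -opprB oppr_eq0.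
rewrite /birth_discount big_nat_recr//= -mulrBr mulrCA [RHS]mulrA -!mulrA.
congr (_ * (_ * _)).
rewrite [X in _ / X + _]big_nat_recr//= [X in _ + X]big_nat_recr//=.
rewrite prod_neq_last.
have -> : \sum_(1 <= m < k.+1) expR (- lam m * s) /
     ((l - lam m) * \prod_(1 <= j < k.+2 | j != m) (lam j - lam m)) =
  (l - lam k.+1)^-1 * (\sum_(1 <= m < k.+1) expR (- lam m * s) /
     ((lam k.+1 - lam m) * \prod_(1 <= j < k.+1 | j != m) (lam j - lam m)) -
  \sum_(1 <= m < k.+1) expR (- lam m * s) /
     ((l - lam m) * \prod_(1 <= j < k.+1 | j != m) (lam j - lam m))).
  rewrite -sumrB big_distrr/= big_nat_cond [RHS]big_nat_cond.
  apply: eq_bigr => m; rewrite andbT => /andP[m0 mk].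
  rewrite prod_neqS ?m0//.
  have ? : lam k.+1 - lam m != 0 by rewrite lam_neq// gt_eqF.
  have ? : l - lam m != 0 by rewrite subr_eq0 lneq// m0 ltnW.
  have ? : \prod_(1 <= j < k.+1 | j != m) (lam j - lam m) != 0.
    rewrite big_nat_cond prodf_seq_neq0; apply/allP => j _; apply/implyP.
    by move=> /andP[/andP[j0 _] jm]; exact: lam_neq.
  field; by do ?[apply/andP; split].
have ? : \prod_(1 <= j < k.+1) (lam j - l) != 0.
  rewrite big_nat_cond prodf_seq_neq0; apply/allP => j _; apply/implyP.
  by move=> /andP[/andP[j0 jk] _]; rewrite subr_eq0 eq_sym lneq// j0 ltnW.
have ? : \prod_(1 <= j < k.+1) (lam j - lam k.+1) != 0.
  rewrite big_nat_cond prodf_seq_neq0; apply/allP => j _; apply/implyP.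
  by move=> /andP[/andP[j0 jk] _]; rewrite lam_neq// ltn_eqF.
set A := \sum_(_ <= _ < _) _; set B := \sum_(_ <= _ < _) _.
field; by do ?[apply/andP; split].
Qed.

(** Kept linear in [e] on purpose: [e m = exp (- lam m * s)] gives the probability of state [k] at
    time [s], and the Laplace transform of the passage time at [lam m] gives that of state [k] at
    the passage time. *)
Definition birth_state_coef (k : nat) (e : nat -> R) : R :=
  (\prod_(1 <= j < k) lam j) *
  \sum_(1 <= m < k.+1) e m / \prod_(1 <= l < k.+1 | l != m) (lam l - lam m).

(** At [l = lam k.+1] the separate term of [birth_discount] turns into the summand [m = k.+1], and
    [l - lam m] into the missing factor of the other products. *)
Lemma birth_discount_state (k : nat) (s : R) :
  birth_discount k (lam k.+1) s =
  birth_state_coef k.+1 (fun m => expR (- lam m * s)).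
Proof.
rewrite /birth_discount /birth_state_coef [X in _ = _ * X]big_nat_recr//= prod_neq_last.
rewrite [X in _ = _ * (X + _)](_ : _ = \sum_(1 <= m < k.+1) expR (- lam m * s) /
     ((lam k.+1 - lam m) * \prod_(1 <= j < k.+1 | j != m) (lam j - lam m))).
  by rewrite addrC.
rewrite big_nat_cond [RHS]big_nat_cond.
apply: eq_bigr => m; rewrite andbT => mk; rewrite prod_neqS//.
by rewrite [_ * (lam k.+1 - _)]mulrC.
Qed.

(** By induction on [k]: passing to [k.+1] multiplies the coefficient of [e m] by
    [1 + lam m / (lam k.+1 - lam m)], which equals [lam k.+1 / (lam k.+1 - lam m)]. *)
Lemma sum_birth_state_coef (k : nat) (e : nat -> R) :
  \sum_(1 <= j < k.+1) birth_state_coef j e =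
  \sum_(1 <= m < k.+1)
    (\prod_(1 <= l < k.+1 | l != m) (lam l / (lam l - lam m))) * e m.
Proof.
elim: k => [|k IH]; first by rewrite !big_geq.
rewrite big_nat_recr//= IH /birth_state_coef [X in _ * X]big_nat_recr//=.
rewrite [RHS]big_nat_recr//= !prod_neq_last mulrDr addrA big_distrr/= -big_split/=.
congr (_ + _); last by rewrite prodf_div; ring.
rewrite big_nat_cond [RHS]big_nat_cond.
apply: eq_bigr => m; rewrite andbT => /andP[m0 mk]; rewrite !prod_neqS ?m0//.
have ? : lam k.+1 - lam m != 0 by rewrite lam_neq// gt_eqF.
have ? : \prod_(1 <= j < k.+1 | j != m) (lam j - lam m) != 0.
  rewrite big_nat_cond prodf_seq_neq0; apply/allP => j _; apply/implyP.
  by move=> /andP[/andP[j0 _] jm]; exact: lam_neq.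
have -> : \prod_(1 <= j < k.+1) lam j =
    lam m * \prod_(1 <= j < k.+1 | j != m) lam j.
  by rewrite (bigD1_seq m) ?mem_index_iota ?m0 ?iota_uniq.
rewrite prodf_div; field; by do ?[apply/andP; split].
Qed.

End discount_formula.

(** * Jump times of the birth process *)

Section birth_times.
Context {R : realType} {d : measure_display} {T : measurableType d}.
Context {P : probability T R} (lam : nat -> R) (W : nat -> {RV P >-> R}).
Hypothesis lam_gt0 : forall k, (0 < k)%N -> 0 < lam k.
Hypothesis lam_inj : forall j k : nat, (0 < j)%N -> (0 < k)%N -> j <> k ->
  lam j <> lam k.
Hypothesis distW : forall (k : nat) (A : set R), (0 < k)%N -> measurable A ->
  distribution P (W k) A = exponential_prob (lam k) A.
Hypothesis indepW : mutually_independent P (fun k => W k.+1 : T -> R).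
Hypothesis W_gt0 : forall (k : nat) w, (0 < k)%N -> 0 < W k w.

Definition jump_time (k : nat) (w : T) : R := \sum_(1 <= j < k.+1) W j w.

Lemma jump_time0 w : jump_time 0 w = 0.
Proof. by rewrite /jump_time big_geq. Qed.

Lemma jump_timeS k w : jump_time k.+1 w = jump_time k w + W k.+1 w.
Proof. by rewrite /jump_time big_nat_recr. Qed.

Lemma jump_time_lt k w : jump_time k w < jump_time k.+1 w.
Proof. by rewrite jump_timeS ltrDl W_gt0. Qed.

Lemma jump_time_homo w : {homo jump_time ^~ w : j k / (j <= k)%N >-> j <= k}.
Proof.
apply: homo_leq => [x|y x z|k]; [exact: lexx|exact: le_trans|].
exact/ltW/jump_time_lt.
Qed.

Lemma jump_time_ge0 k w : 0 <= jump_time k w.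
Proof. by rewrite -(jump_time0 w) jump_time_homo. Qed.

(** With [X i = W i.+1], the [k]-th jump time involves [X 0, ..., X (k - 1)], exactly the past of
    the next holding time [X k]. *)
Lemma measurable_jump_time_past k : measurable_fun setT
  (jump_time k : g_sigma_algebraType (past_cylinders (fun k => W k.+1 : T -> R) k)
                 -> R).
Proof.
rewrite [X in measurable_fun _ X](_ : _ =
    fun w => \sum_(i < k) (fun i w => W i.+1 w) (i : nat) w).
  apply: measurable_sum => i.
  exact: (measurable_fun_past (X := fun k => W k.+1) (ltn_ord i)).
by apply/funext => w; rewrite /jump_time big_add1 big_mkord.
Qed.

Lemma measurable_jump_time k : measurable_fun setT (jump_time k).
Proof. by apply: measurable_sum => i. Qed.

Let probE (A : set T) : measurable A -> P A = (\int[P]_w (\1_A w)%:E)%E.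
Proof. by move=> mA; rewrite integral_indic// setIT. Qed.

(** The quantity [h k l s] of the header. *)
Definition discount_integral k l s : \bar R :=
  (\int[P]_w (expR (- l * (s - jump_time k w)) * \1_`]-oo, s] (jump_time k w))%:E)%E.

Let discount_ge0 k l s w :
  (0 <= (expR (- l * (s - jump_time k w)) * \1_`]-oo, s] (jump_time k w))%:E)%E.
Proof. by rewrite lee_fin mulr_ge0 ?expR_ge0. Qed.

Let measurable_discount (l s : R) : measurable_fun setT
  (fun x : R => (expR (- l * (s - x)) * \1_`]-oo, s] x)).
Proof.
apply: measurable_funM => //.
apply: measurableT_comp => //; apply: measurable_funM => //.
exact: measurable_funB.
Qed.

Let measurable_discount_jump k (l s : R) : measurable_fun setT
  (fun w => (expR (- l * (s - jump_time k w)) * \1_`]-oo, s] (jump_time k w))%:E).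
Proof.
apply/measurable_EFinP.
exact: (measurableT_comp (measurable_discount l s) (measurable_jump_time k)).
Qed.

Lemma discount_integral0 l s : 0 <= s ->
  discount_integral 0 l s = (expR (- l * s))%:E.
Proof.
move=> s0; rewrite /discount_integral.
under eq_integral do rewrite jump_time0 subr0 indicE mem_set/= ?in_itv//= mulr1.
by rewrite integral_cst//= [X in (_ * X)%E]probability_setT mule1.
Qed.

(** Condition on the [k]-th jump time [x] and integrate the next holding time with [r = s - x]; for
    [x > s] everything vanishes. Finiteness of [a] and [b] supplies the integrability needed to
    split the difference. *)
Lemma discount_integralS k (l s a b : R) : l != lam k.+1 ->
  discount_integral k (lam k.+1) s = a%:E -> discount_integral k l s = b%:E ->
  discount_integral k.+1 l s = (lam k.+1 / (l - lam k.+1) * (a - b))%:E.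
Proof.
move=> lneq Ea Eb.
pose phi (z : R * R) := (expR (- l * (s - (z.1 + z.2))) * \1_`]-oo, s] (z.1 + z.2))%:E.
have mphi : measurable_fun setT phi.
  apply/measurable_EFinP.
  apply: (measurableT_comp (measurable_discount l s)).
  exact: measurable_funD.
have -> : discount_integral k.+1 l s =
    (\int[P]_w phi (jump_time k w, W k.+1 w))%E.
  by apply: eq_integral => w _; rewrite jump_timeS.
rewrite (ge0_integral_past (X := fun k => W k.+1)) //; last 2 first.
- exact: measurable_jump_time_past.
- by move=> z; rewrite lee_fin mulr_ge0 ?expR_ge0.
have inner w' : (\int[P]_w phi (jump_time k w', W k.+1 w) =
    (lam k.+1 / (l - lam k.+1))%:E *
    ((expR (- lam k.+1 * (s - jump_time k w')) * \1_`]-oo, s] (jump_time k w'))%:E -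
     (expR (- l * (s - jump_time k w')) * \1_`]-oo, s] (jump_time k w'))%:E))%E.
  set x := jump_time k w'.
  have [xs|sx] := leP x s.
    rewrite indicE mem_set/= ?in_itv//= !mulr1 -EFinB -EFinM.
    rewrite -(@integral_exponential_discount _ _ _ P (W k.+1)) ?subr_ge0 ?lam_gt0//.
      apply: eq_integral => w _; rewrite /phi/= !indicE !mem_setE !in_itv/=.
      by rewrite lerBrDl opprD addrA.
    by move=> A; exact: distW.
  rewrite indicE memNset/= ?in_itv/= ?leNgt ?sx// !mulr0 subee// mule0.
  apply: integral0_eq => w _; rewrite /phi/= indicE memNset/= ?mulr0//.
  by rewrite in_itv/= leNgt (lt_le_trans sx)// lerDl ltW ?W_gt0.
under eq_integral do rewrite inner.
have integ u c : discount_integral k u s = c%:E -> P.-integrable setT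
    (fun w => (expR (- u * (s - jump_time k w)) * \1_`]-oo, s] (jump_time k w))%:E).
  move=> E; apply/integrableP; split; first exact: measurable_discount_jump.
  under eq_integral do rewrite gee0_abs//.
  by rewrite -/(discount_integral k u s) E ltry.
rewrite integralZl//; last by apply: integrableB => //; [exact: integ Ea|exact: integ Eb].
rewrite integralB//; [|exact: integ Ea|exact: integ Eb].
by rewrite -!/(discount_integral _ _ _) Ea Eb -EFinB -EFinM.
Qed.

(** The induction quantifies over [l], as the recursion calls the previous stage both at [l] and at
    [lam k.+1]; distinctness of the rates makes the latter admissible. *)
Lemma discount_integralE k (l s : R) : 0 <= s ->
    (forall j, (0 < j < k.+1)%N -> l != lam j) ->
  discount_integral k l s = (birth_discount lam k l s)%:E.
Proof.
move=> s0; elim: k l => [|k IH] l lneq.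
  rewrite discount_integral0// /birth_discount !big_geq//.
  by rewrite mul1r divr1 addr0.
rewrite (@birth_discountS _ lam lam_inj)//; apply: discount_integralS.
- by rewrite lneq// leqnn.
- by apply: IH => j /andP[j0 jk]; apply/eqP/lam_inj => //; apply/eqP; rewrite gtn_eqF.
- by apply: IH => j /andP[j0 jk]; apply: lneq; rewrite j0 ltnW.
Qed.

(** Given a [k]-th jump at [x <= s], the next holding time exceeds [s - x] with probability
    [exp (- lam k.+1 * (s - x))]: this is the integrand of [h k (lam k.+1) s]. *)
Lemma birth_state_prob k (s : R) : 0 <= s ->
  P [set w | jump_time k w <= s < jump_time k.+1 w] =
  (birth_state_coef lam k.+1 (fun m => expR (- lam m * s)))%:E.
Proof.
move=> s0; rewrite -birth_discount_state -discount_integralE//; last first.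
  by move=> j /andP[j0 jk]; apply/eqP/lam_inj => //; apply/eqP; rewrite gtn_eqF.
pose phi (z : R * R) := (\1_`]-oo, s] z.1 * \1_`]s, +oo[ (z.1 + z.2) : R)%:E.
have mphi : measurable_fun setT phi.
  apply/measurable_EFinP/measurable_funM.
    by apply: measurableT_comp => //.
  apply: (measurableT_comp (measurable_indic _)) => //.
  exact: measurable_funD.
have mS : measurable [set w | jump_time k w <= s < jump_time k.+1 w].
  rewrite (_ : [set w | _] = (jump_time k @^-1` `]-oo, s]) `&`
                             (jump_time k.+1 @^-1` `]s, +oo[)).
    apply: measurableI; rewrite -[X in measurable X]setTI;
      exact: measurable_jump_time.
  by apply/seteqP; split=> w /=; rewrite !in_itv/= andbT; [move/andP|move=> [-> ->]].
transitivity (\int[P]_w phi (jump_time k w, W k.+1 w))%E.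
  rewrite probE//.
  apply: eq_integral => w _; rewrite /phi !indicE -natrM mulnb/=.
  congr ((nat_of_bool _)%:R%:E).
  by rewrite !mem_setE/= !in_itv/= -jump_timeS andbT.
rewrite (ge0_integral_past (X := fun k => W k.+1)) //; last 2 first.
- exact: measurable_jump_time_past.
- by move=> z; rewrite lee_fin mulr_ge0.
apply: eq_integral => w' _; set x := jump_time k w'.
have [xs|sx] := leP x s; last first.
  rewrite indicE memNset/= ?in_itv/= ?leNgt ?sx// !mulr0.
  apply: integral0_eq => w _; rewrite /phi/= indicE memNset/= ?mul0r//.
  by rewrite in_itv/= leNgt sx.
rewrite [in RHS]indicE mem_set/= ?in_itv//= !mulr1.
rewrite -(@exponential_tail _ _ _ P (W k.+1)) ?subr_ge0//; last 2 first.
- by move=> A; exact: distW.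
- by move=> w; exact: W_gt0.
have mtail : measurable [set w | s - x < W k.+1 w].
  rewrite (_ : [set w | _] = (W k.+1 @^-1` `]s - x, +oo[)).
    exact: measurable_funPTI.
  by apply/seteqP; split=> w /=; rewrite in_itv/= andbT.
rewrite probE//.
apply: eq_integral => w _; rewrite /phi/= !indicE mem_set/= ?in_itv//= mul1r.
rewrite mem_setE in_itv/= andbT.
congr ((nat_of_bool _)%:R%:E); apply/idP/idP => [sxW|/set_mem/=].
  by apply/mem_set; rewrite /= ltrBlDl.
by rewrite ltrBlDl.
Qed.

(* [h k (-1) s] dominates the left-hand side, since its integrand is at least
   [1] on the event. *)
Lemma jump_time_bound k (s : R) : 0 <= s ->
  (P [set w | (jump_time k w <= s)%R] <=
   (expR s * \prod_(1 <= j < k.+1) (lam j / (1 + lam j)))%:E)%E.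
Proof.
move=> s0; have neq1 j : (0 < j)%N -> -1 != lam j.
  by move=> j0; rewrite lt_eqF// (lt_trans _ (lam_gt0 j0))// ltrN10.
have mS : measurable [set w | jump_time k w <= s].
  rewrite (_ : [set w | _] = (jump_time k @^-1` `]-oo, s])).
    by rewrite -[X in measurable X]setTI; exact: measurable_jump_time.
  by apply/seteqP; split=> w /=; rewrite !in_itv/=.
apply: (@le_trans _ _ (discount_integral k (-1) s)).
  rewrite probE//.
  apply: ge0_le_integral => //.
    exact/measurable_EFinP/measurable_indic.
  move=> w _; rewrite lee_fin !indicE opprK mul1r.
  have [js|js] := leP (jump_time k w) s.
    by rewrite !mem_set/= ?in_itv//= mulr1 -expR0 ler_expR subr_ge0.
  by rewrite !memNset ?mulr0//= ?in_itv/= leNgt js.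
have discE j : discount_integral j (-1) s = (birth_discount lam j (-1) s)%:E.
  by apply: discount_integralE => // i /andP[i0 _]; exact: neq1.
rewrite discE lee_fin; elim: k {mS} => [|k IH].
  by rewrite /birth_discount !big_geq// opprK !mul1r divr1 addr0 mulr1.
rewrite (@birth_discountS _ lam lam_inj); last by move=> j /andP[? _]; exact: neq1.
have l0 := lam_gt0 (ltn0Sn k).
have -> : lam k.+1 / (-1 - lam k.+1) = - (lam k.+1 / (1 + lam k.+1)).
  by rewrite -opprD invrN mulrN.
rewrite mulNr -mulrN opprB big_nat_recr//= mulrA [leRHS]mulrC.
rewrite ler_wpM2l//; first by rewrite divr_ge0// ?addr_ge0 ?ltW.
apply: le_trans IH; rewrite gerBl -lee_fin -discount_integralE//.
  by apply: integral_ge0.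
by move=> j /andP[j0 jk]; apply/eqP/lam_inj => //; apply/eqP; rewrite gtn_eqF.
Qed.

End birth_times.

(** * Exponential martingale stopped on a grid *)

Section stopped_exponential_martingale.
Context {R : realType} {d : measure_display} {T : measurableType d}.
Context {P : probability T R} (X : nat -> T -> R).
Hypothesis mX : forall i, measurable_fun setT (X i).
Hypothesis indepX : mutually_independent P X.

Definition walk (j : nat) (w : T) : R := \sum_(i < j) X i w.

(* Equal to [m] when the level is not reached before step [m]. *)
Definition walk_hit (a : R) (m : nat) (w : T) : nat :=
  find (fun j => a <= walk j w) (iota 0 m).

Definition exp_walk (th c : R) (j : nat) (w : T) : R :=
  expR (th * walk j w - c * j%:R).

Lemma measurable_walk_past j n : (j <= n)%N -> measurable_fun setT
  (walk j : g_sigma_algebraType (past_cylinders X n) -> R).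
Proof.
move=> jn; apply: measurable_sum => i.
by apply: measurable_fun_past; exact: leq_trans jn.
Qed.

Lemma measurable_walk j : measurable_fun setT (walk j).
Proof. exact: measurable_sum. Qed.

(** Indicator that the level is not reached up to step [m] included; as a product it is visibly a
    function of the first [m] increments. *)
Let below (a : R) (m : nat) (w : T) : R :=
  \prod_(j < m.+1) \1_`]-oo, a[ (walk j w).

Let belowE a m w : below a m w =
  (~~ has (fun j => a <= walk j w) (iota 0 m.+1))%:R.
Proof.
rewrite /below -(big_mkord xpredT (fun j => \1_`]-oo, a[ (walk j w))).
rewrite /index_iota subn0; elim: (iota _ _) => [|j s IH].
  by rewrite big_nil.
rewrite big_cons IH/= indicE mem_setE in_itv/= negb_or -ltNge.
by case: (_ < _); rewrite (mul1r, mul0r).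
Qed.

(** Either the level is reached by step [m] and one more step changes nothing, or the walk goes on
    and gains the factor of the increment [X m]. *)
Let exp_walk_hitS a m th c w : exp_walk th c (walk_hit a m.+1 w) w =
  exp_walk th c (walk_hit a m w) w * (1 - below a m w) +
  below a m w * exp_walk th c m w * expR (th * X m w - c).
Proof.
rewrite belowE /walk_hit -addn1 iotaD add0n has_cat find_cat/= size_iota.
case: ifP => hm /=; first by rewrite subr0 mulr1 !mul0r addr0.
rewrite orbF; case: ifP => am /=.
  by rewrite subr0 mulr1 !mul0r addr0 addn0 hasNfind ?hm ?size_iota.
rewrite subrr mulr0 add0r mul1r addn1 /exp_walk -expRD /walk big_ord_recr/=.
by congr expR; rewrite -[in LHS]natr1; ring.
Qed.

(** The same splitting at horizon [m]: it differs from that at [m.+1] only by the factor of the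
    increment. *)
Let exp_walk_hit_split a m th c w : exp_walk th c (walk_hit a m w) w =
  exp_walk th c (walk_hit a m w) w * (1 - below a m w) +
  below a m w * exp_walk th c m w.
Proof.
rewrite belowE /walk_hit -addn1 iotaD add0n has_cat/=.
have [hm|hm] /= := boolP (has (fun j => a <= walk j w) (iota 0 m)).
  by rewrite subr0 mulr1 mul0r addr0.
rewrite orbF; have [am|am] /= := boolP (a <= walk m w).
  by rewrite subr0 mulr1 mul0r addr0.
by rewrite subrr mulr0 add0r mul1r hasNfind// size_iota.
Qed.

Let below01 a m w : 0 <= below a m w <= 1.
Proof. by rewrite belowE; case: has; rewrite /= ?lexx ler01. Qed.

Lemma measurable_exp_walk th c j : measurable_fun setT (exp_walk th c j).
Proof.
apply: measurableT_comp => //; apply: measurable_funB => //.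
by apply: measurable_funM => //; exact: measurable_walk.
Qed.

Let measurable_below a m : measurable_fun setT (below a m).
Proof.
apply: measurable_prod => j _.
exact: (measurableT_comp (measurable_indic _) (measurable_walk j)).
Qed.

Lemma measurable_exp_walk_hit a m th c :
  measurable_fun setT (fun w => exp_walk th c (walk_hit a m w) w).
Proof.
elim: m => [|m IH]; first exact: measurable_exp_walk.
under eq_fun do rewrite exp_walk_hitS.
apply: measurable_funD; apply: measurable_funM => //.
- exact: measurable_funB.
- by apply: measurable_funM => //; exact: measurable_exp_walk.
- apply: measurableT_comp => //; apply: measurable_funB => //.
  exact: measurable_funM.
Qed.

(** Optional stopping by induction on the horizon: the event of going on depends on the past of
    [X m], whose exponential factor has mean [1]. *)
Lemma integral_exp_walk_hit a m th c :
    (forall i, \int[P]_w (expR (th * X i w - c))%:E = 1)%E ->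
  (\int[P]_w (exp_walk th c (walk_hit a m w) w)%:E = 1)%E.
Proof.
move=> step1; elim: m => [|m IH].
  rewrite /walk_hit/= /exp_walk /walk.
  under eq_integral do rewrite big_ord0 !mulr0 subr0 expR0.
  by rewrite integral_cst//= [X in (_ * X)%E]probability_setT mule1.
rewrite -[RHS]IH; under eq_integral do rewrite exp_walk_hitS EFinD.
under [in RHS]eq_integral do rewrite exp_walk_hit_split EFinD.
have mG := measurable_exp_walk_hit a m th c.
have mB : measurable_fun setT (fun w => (exp_walk th c (walk_hit a m w) w *
    (1 - below a m w))%:E).
  by apply/measurable_EFinP/measurable_funM => //; exact: measurable_funB.
have mM := measurable_exp_walk th c m.
have B0 w : (0 <= (exp_walk th c (walk_hit a m w) w * (1 - below a m w))%:E)%E.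
  by rewrite lee_fin mulr_ge0 ?expR_ge0// subr_ge0; case/andP: (below01 a m w).
have M0 w : 0 <= below a m w * exp_walk th c m w.
  by rewrite mulr_ge0 ?expR_ge0//; case/andP: (below01 a m w).
have mBM : measurable_fun setT (fun w => below a m w * exp_walk th c m w).
  exact: measurable_funM.
rewrite ge0_integralD//; last 2 first.
- by move=> w _; rewrite lee_fin mulr_ge0// expR_ge0.
- apply/measurable_EFinP/measurable_funM => //.
  apply: measurableT_comp => //; apply: measurable_funB => //.
  exact: measurable_funM.
rewrite ge0_integralD//; last 2 first.
- by move=> w _; rewrite lee_fin.
- exact/measurable_EFinP.
congr (_ + _)%E.
(* The absolute value makes [phi] nonnegative everywhere; it is harmless at the values actually
   taken. *)
pose phi (z : R * R) := (`|z.1| * expR (th * z.2 - c))%:E.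
transitivity (\int[P]_w phi ((below a m w * exp_walk th c m w)%R, X m w))%E.
  by apply: eq_integral => w _; rewrite /phi/= ger0_norm.
rewrite (ge0_integral_past (X := X)
  (Y := fun w => below a m w * exp_walk th c m w))//.
- apply: eq_integral => w' _; rewrite /phi/= ger0_norm//.
  under eq_integral do rewrite EFinM.
  rewrite ge0_integralZl//; first by rewrite step1 mule1.
  + apply/measurable_EFinP/measurableT_comp => //; apply: measurable_funB => //.
    exact: measurable_funM.
  + by rewrite lee_fin.
- apply: measurable_funM.
    apply: measurable_prod => j _.
    apply: (measurableT_comp (measurable_indic _)) => //.
    by apply: measurable_walk_past; rewrite -ltnS.
  apply: measurableT_comp => //; apply: measurable_funB => //.
  by apply: measurable_funM => //; exact: measurable_walk_past.
- apply/measurable_EFinP/measurable_funM; first exact: measurableT_comp.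
  apply: measurableT_comp => //; apply: measurable_funB => //.
  exact: measurable_funM.
- by move=> z; rewrite lee_fin mulr_ge0// expR_ge0.
Qed.

End stopped_exponential_martingale.

Section brownian_grid.
Context {R : realType} {d : measure_display} {T : measurableType d}.
Context {P : probability T R} (B : R -> {RV P >-> R}).
Hypothesis brownB : standard_brownian_motion P B.

Lemma integral_exp_normal (X : {RV P >-> R}) (h th : R) : 0 < h ->
    (forall A, measurable A -> P (X @^-1` A) = normal_prob 0 (Num.sqrt h) A) ->
  (\int[P]_w (expR (th * X w - th ^+ 2 / 2 * h))%:E = 1)%E.
Proof.
move=> h0 distX; have sh0 : Num.sqrt h != 0 by rewrite gt_eqF// sqrtr_gt0.
have mX : measurable_fun setT (X : T -> measurableTypeR R) := measurable_funP X.
pose f (x : R) := (expR (th * x - th ^+ 2 / 2 * h))%:E.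
have mf : measurable_fun setT f.
  apply/measurable_EFinP; apply: measurableT_comp => //.
  by apply: measurable_funB => //; exact: measurable_funM.
have f0 x : (0 <= f x)%E by rewrite lee_fin expR_ge0.
transitivity (\int[pushforward P (X : T -> measurableTypeR R)]_y f y)%E.
  by rewrite (ge0_integral_pushforward mX).
transitivity (\int[normal_prob 0 (Num.sqrt h)]_y f y)%E.
  by apply: eq_measure_integral => A mA _; exact: distX.
rewrite (@ge0_integral_density _ _ _ lebesgue_measure (normal_prob 0 (Num.sqrt h))
  (normal_pdf 0 (Num.sqrt h)))//.
(* Completing the square: the exponential factor shifts the mean of the normal density from [0] to
   [th * h]. *)
- rewrite -(integral_normal_pdf (th * h) (Num.sqrt h)).
  apply: eq_integral => x _; rewrite /f -EFinM !normal_pdfE//; congr EFin.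
  rewrite mulrCA /normal_fun -expRD sqr_sqrtr ?ltW//; congr (_ * expR _).
  by field; rewrite gt_eqF.
- exact: measurable_normal_pdf.
- by move=> x; exact: normal_pdf_ge0.
Qed.

Definition grid_increment (h : R) (i : nat) (w : T) : R :=
  B (i.+1%:R * h) w - B (i%:R * h) w.

Lemma walk_grid_increment h j w :
  walk (grid_increment h) j w = B (j%:R * h) w - B 0 w.
Proof.
rewrite /walk; elim: j => [|j IH]; first by rewrite big_ord0 mul0r subrr.
by rewrite big_ord_recr/= IH /grid_increment addrC subrKA.
Qed.

Lemma integral_grid_hit (a th h : R) (m : nat) : 0 < h ->
  (\int[P]_w (exp_walk (grid_increment h) th (th ^+ 2 / 2 * h)
                (walk_hit (grid_increment h) a m w) w)%:E = 1)%E.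
Proof.
move=> h0; have [_ _ indep norm] := brownB.
apply: integral_exp_walk_hit.
- by move=> i; exact: measurable_funB.
- apply: (indep (fun i => i%:R * h)); first by rewrite mul0r.
  by move=> i j ij; rewrite ler_wpM2r ?ler_nat// ltW.
move=> i; pose Z : {RV P >-> R} := B (i.+1%:R * h) \- B (i%:R * h).
apply: (integral_exp_normal (X := Z)) => // A mA.
have -> : h = i.+1%:R * h - i%:R * h by rewrite -mulrBl -natrB// subSnn mul1r.
apply: norm => //; first by rewrite mulr_ge0// ltW.
by rewrite ltr_pM2r// ltr_nat.
Qed.

End brownian_grid.

(** * Passage times of continuous paths *)

Section continuous_paths.
Context {R : realType}.
Implicit Types (b : R -> R).

Lemma continuous_max0_path b : {within `[0, +oo[, continuous b} ->
  continuous (fun s : R => b (Num.max 0 s)).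
Proof.
move=> /subspace_continuousP cb x.
have A (s : R) : `[0, +oo[%classic (Num.max 0 s).
  by rewrite /= in_itv/= andbT le_max lexx.
apply: (cvg_trans _ (cb _ (A x))).
have cmax : {for x, continuous (Num.max (0 : R))}.
  exact: (continuous_max (@cst_continuous _ _ 0 x) (@cvg_id _ (nbhs x))).
move=> U /= HU; have HU' := cmax _ HU.
(* Membership in a limit within a set unfolds to an implication, whose premise holds at every point
   by [A]. *)
change (nbhs x (fun s : R => `[0%R, +oo[%classic (Num.max 0 s) -> U (b (Num.max 0 s)))) in HU'.
change (nbhs x (fun s : R => U (b (Num.max 0 s)))).
by apply: filterS HU' => s; apply; exact: A.
Qed.

(** The condition on the right is countable, whence measurability below. It follows from a hit by
    taking rationals just after [s]; conversely, [|b - t|] attains its minimum on [[0, q]], and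
    rational times force this minimum to be [0]. *)
Lemma path_hit_before_rat b (t c : R) : continuous b ->
  (exists2 s, 0 <= s < c & b s = t) <->
  (exists2 q : rat, 0 <= (ratr q : R) < c &
    forall n, exists2 r : rat, 0 <= (ratr r : R) <= ratr q &
      `|b (ratr r) - t| < n.+1%:R^-1).
Proof.
move=> cb; split=> [[s /andP[s0 sc] bs]|[q /andP[q0 qc] H]].
  have [q] := rat_in_itvoo sc; rewrite in_itv/= => /andP[sq qc].
  exists q; first by rewrite qc (le_trans s0 (ltW sq)).
  move=> n; have n0 : 0 < n.+1%:R^-1 :> R by rewrite invr_gt0.
  have /cvgrPdist_lt/(_ _ n0) := cb s.
  move=> /nbhs_ballP[e /= e0 /= He].
  have [|r] := @rat_in_itvoo R s (Num.min (s + e) (ratr q)) _.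
    by rewrite lt_min sq ltrDl e0.
  rewrite in_itv/= lt_min => /andP[sr /andP[re rq]].
  exists r; first by rewrite (ltW rq) (le_trans s0 (ltW sr)).
  rewrite distrC -bs; apply: He; rewrite /ball/= distrC gtr0_norm ?subr_gt0//.
  by rewrite ltrBlDl.
have cg : continuous (fun s => `|b s - t|).
  move=> s; apply: cvg_norm; apply: (@cvgB _ R^o); [exact: cb|exact: cvg_cst].
have [p p0q pmin] := EVT_min q0 (continuous_subspaceT cg).
have [bp|bp] := eqVneq (b p) t.
  by exists p => //; move: p0q; rewrite in_itv/= => /andP[-> /le_lt_trans->].
have gp : 0 < `|b p - t| by rewrite normr_gt0 subr_eq0.
have [n] := ltr_add_invr gp; rewrite add0r => np.
have [r r0q] := H n; move=> /lt_trans/(_ np); rewrite ltNge.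
by rewrite pmin// in_itv/=.
Qed.

End continuous_paths.

Section measurable_passage.
Context {R : realType} {d : measure_display} {T : measurableType d}.
Variables (b : R -> T -> R).
Hypothesis mb : forall s, 0 <= s -> measurable_fun setT (b s).
Hypothesis cb : forall w, {within `[0, +oo[, continuous (b^~ w)}.

Lemma first_passage_time_ltP t c w : (first_passage_time b t w < c%:E)%E <->
  exists2 s, 0 <= s < c & b s w = t.
Proof.
split=> [/ereal_inf_lt[_ [s [s0 bs] <-]]|[s /andP[s0 sc] bs]].
  by rewrite lte_fin => sc; exists s => //; rewrite s0.
apply: (@le_lt_trans _ _ s%:E); last by rewrite lte_fin.
by apply: ereal_inf_lbound; exists s.
Qed.

Lemma first_passage_time_ge0 t w : (0 <= first_passage_time b t w)%E.
Proof. by apply: le_ereal_inf_tmp => _ [s [s0 _] <-]; rewrite lee_fin. Qed.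

Lemma measurable_first_passage_time t :
  measurable_fun setT (first_passage_time b t).
Proof.
apply: (measurability _ (ErealGenInftyO.measurableE R)) => //.
move=> _ [_ [c ->] <-]; rewrite setTI.
rewrite (_ : _ @^-1` _ = \bigcup_(q : rat) (if 0 <= (ratr q : R) < c then
   \bigcap_n \bigcup_(r : rat) (if 0 <= (ratr r : R) <= ratr q then
      [set w | `|b (Num.max 0 (ratr r)) w - t| < n.+1%:R^-1] else set0) else set0)).
  apply: bigcupT_measurable_rat => q; case: ifP => // _.
  apply: bigcapT_measurable => n; apply: bigcupT_measurable_rat => r.
  case: ifP => // _; rewrite -[X in measurable X]setTI.
  have mg : measurable_fun setT (fun w => `|b (Num.max 0 (ratr r)) w - t|).
    apply: measurableT_comp => //; apply: measurable_funB => //.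
    by apply: mb; rewrite le_max lexx.
  have := mg measurableT _ (measurable_itv `]-oo, n.+1%:R^-1[).
  by rewrite preimage_itvNyo.
apply/seteqP; split=> w /=; rewrite in_itv/=.
  move=> /first_passage_time_ltP[s /andP[s0 sc] bs].
  have [|q qc H] := (path_hit_before_rat t c (continuous_max0_path (@cb w))).1.
    by exists s; rewrite ?s0//= max_r.
  exists q => //; rewrite qc => n _.
  by have [r rq nr] := H n; exists r => //; rewrite rq.
move=> [q _]; case: ifP => // qc H; apply/first_passage_time_ltP.
have [|s /andP[s0 sc] bs] := (path_hit_before_rat t c (continuous_max0_path (@cb w))).2.
  by exists q => // n; have [r _] := H n I; case: ifP => // rq nr; exists r.
by exists s; rewrite ?s0// -bs/= max_r.
Qed.

End measurable_passage.

Section grid_hitting.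
Context {R : realType}.
Variable b : R -> R.
Hypothesis cb : continuous b.

(** Counterpart of [walk_hit] for a single path sampled with mesh [h], again equal to [m] when there
    is no hit. *)
Definition grid_hit (a h : R) (m : nat) : nat :=
  find (fun j => a <= b (j%:R * h)) (iota 0 m).

Lemma grid_hit_le a h m : (grid_hit a h m <= m)%N.
Proof. by rewrite -[leqRHS](size_iota 0 m); exact: find_size. Qed.

Lemma grid_hit_before a h m j : (j < grid_hit a h m)%N -> b (j%:R * h) < a.
Proof.
move=> jlt; have jm : (j < m)%N := leq_trans jlt (grid_hit_le a h m).
by have := before_find 0%N jlt; rewrite nth_iota// add0n ltNge => ->.
Qed.

Lemma grid_hit_at a h m : (grid_hit a h m < m)%N ->
  a <= b ((grid_hit a h m)%:R * h).
Proof.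
move=> lt; have := @nth_find _ 0%N (fun j => a <= b (j%:R * h)) (iota 0 m).
by rewrite has_find size_iota nth_iota// add0n; exact.
Qed.

(** Since [a < t], continuity keeps the path above [a] just after [s], so a fine grid detects it
    there. Mesh [1 / (n + 1)] with [(n + 1)^2] steps covers [[0, n + 1[], a horizon that grows as
    the mesh shrinks. *)
Lemma grid_hit_after (a t s e : R) : 0 <= s -> b s = t -> a < t -> 0 < e ->
  \forall n \near \oo, let j := (grid_hit a n.+1%:R^-1 (n.+1 ^ 2))%:R / n.+1%:R in
    a <= b j /\ j <= s + e.
Proof.
move=> s0 bs at0 e0.
have /cvgrPdist_lt/(_ (t - a)) := @cb s; rewrite subr_gt0 => /(_ at0).
move=> /nbhs_ballP[u /= u0 /= Hu].
near=> n.
have hu : n.+1%:R^-1 < u by near: n; exact: near_infty_natSinv_lt (PosNum u0).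
have he : n.+1%:R^-1 < e by near: n; exact: near_infty_natSinv_lt (PosNum e0).
have sn : s + 1 < n.+1%:R.
  by rewrite -natr1 ltrD2r; near: n; exact: nbhs_infty_gtr.
set h := (n.+1%:R^-1 : R) in hu he *; have h0 : 0 < h by rewrite invr_gt0.
have h1 : h <= 1 by rewrite invf_le1// ler1n.
(* The first grid index strictly after time [s]. *)
pose i := (Num.truncn (s / h)).+1.
have sh0 : 0 <= s / h by rewrite divr_ge0// ltW.
have si : s < i%:R * h by rewrite -ltr_pdivrMr// truncnS_gt.
have is_ : i%:R * h <= s + h.
  by rewrite /i -natr1 mulrDl mul1r lerD2r -ler_pdivlMr// truncn_le.
have bi : a <= b (i%:R * h).
  have : ball s u (i%:R * h).
    rewrite /ball/= distrC ger0_norm ?subr_ge0 ?ltW// ltrBlDl.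
    by rewrite (le_lt_trans is_)// ltrD2l.
  by move=> /Hu; rewrite /= bs => /ltr_normlW; rewrite ltrBlDl -ltrBlDr; lra.
have im : (i < n.+1 ^ 2)%N.
  rewrite -(ltr_nat R) -(ltr_pM2r h0) (le_lt_trans is_)//.
  rewrite expnS expn1 natrM -mulrA mulfV ?pnatr_eq0// mulr1.
  by rewrite (le_lt_trans _ sn)// lerD2l.
have hi : (grid_hit a h (n.+1 ^ 2) <= i)%N.
  by rewrite leqNgt; apply/negP => /grid_hit_before; rewrite ltNge bi.
split; first exact: grid_hit_at (leq_ltn_trans hi im).
apply: (@le_trans _ _ (i%:R * h)); first by rewrite ler_wpM2r ?ler_nat// ltW.
by rewrite (le_trans is_)// lerD2l ltW.
Unshelve. all: by end_near. Qed.

Lemma near_uniform_continuous (K e : R) : 0 < e ->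
  \forall n \near \oo, forall x y, 0 <= x <= K -> `|x - y| <= n.+1%:R^-1 ->
    `|b x - b y| <= e.
Proof.
move=> e0.
have /compact_near_coveringP/(_ nat \oo (fun n x => forall y,
  `|x - y| <= n.+1%:R^-1 -> `|b x - b y| <= e)) := @segment_compact R 0 K.
case.
  move=> x xK.
  have /cvgrPdist_lt/(_ (e / 2)) := @cb x; rewrite divr_gt0// => /(_ isT).
  move=> /nbhs_ballP[u /= u0 /= Hu].
  have u20 : 0 < u / 2 by rewrite divr_gt0.
  near=> x' n => y xy.
  have nu : n.+1%:R^-1 < u / 2.
    by near: n; exact: near_infty_natSinv_lt (PosNum u20).
  have xx' : ball x (u / 2) x' by near: x'; exact: nbhsx_ballx.
  have bx' : `|b x - b x'| < e / 2.
    by apply: Hu; apply: le_ball xx'; lra.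
  have bxy : `|b x - b y| < e / 2.
    apply: Hu; rewrite /ball/= -(subrKA x').
    by rewrite (le_lt_trans (ler_normD _ _))// (splitr u) ltrD// (le_lt_trans xy).
  rewrite -(subrKA (b x)) (le_trans (ler_normD _ _))//.
  by rewrite distrC (splitr e) lerD// ltW.
move=> N _ HN; exists N => // n /= Nn x y xK xy.
by apply: (HN n Nn) => //=; rewrite in_itv/=.
Unshelve. all: by end_near. Qed.

(** The grid point preceding the hit lies below [t], so uniform continuity on [[0, K]] bounds the
    overshoot, and the intermediate value theorem yields a true passage no later than the grid
    hit. *)
Lemma grid_hit_before_level (t e : R) (K : nat) :
    b 0 = 0 -> 0 < t -> 0 < e -> (0 < K)%N ->
  \forall n \near \oo, let j := (grid_hit t n.+1%:R^-1 (K * n.+1))%:R / n.+1%:R in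
    b j <= t + e /\ (j = K%:R \/ exists2 s, 0 <= s <= j & b s = t).
Proof.
move=> b0 t0 e0 K0; near=> n.
have unif : forall x y, 0 <= x <= K%:R -> `|x - y| <= n.+1%:R^-1 -> `|b x - b y| <= e.
  by near: n; exact: near_uniform_continuous.
set h := (n.+1%:R^-1 : R) in unif *; set m := (K * n.+1)%N.
have h0 : 0 < h by rewrite invr_gt0.
have mh : m%:R * h = K%:R by rewrite natrM -mulrA mulfV ?pnatr_eq0// mulr1.
have m0 : (0 < m)%N by rewrite muln_gt0 K0.
(* The path starts at [0 < t], so the hit has a preceding grid point. *)
have j0 : (0 < grid_hit t h m)%N.
  rewrite lt0n; apply/eqP => j0; have := @grid_hit_at t h m.
  by rewrite j0 mul0r b0 => /(_ m0); rewrite leNgt t0.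
move: (grid_hit_le t h m) (@grid_hit_before t h m) (@grid_hit_at t h m) j0.
case: (grid_hit t h m) => [//|i] im /(_ i (ltnSn i)) bi bj _.
set j := i.+1%:R * h.
have jK : j <= K%:R by rewrite -mh ler_wpM2r ?ler_nat// ltW.
have jge0 : 0 <= j by rewrite mulr_ge0// ltW.
have ij : j = i%:R * h + h by rewrite /j -natr1 mulrDl mul1r.
have bje : `|b j - b (i%:R * h)| <= e.
  by apply: unif; rewrite ?jge0// ij addrAC subrr add0r gtr0_norm.
split.
  by move: bje => /ler_normlW; rewrite lerBlDl => /le_trans; apply; rewrite lerD2r ltW.
have [ltim|] := ltnP i.+1 m; last first.
  by rewrite leq_eqVlt ltnNge im orbF => /eqP mi; left; rewrite /j -mi.
right; have [|s] := @IVT R b 0 j t jge0 (continuous_subspaceT cb).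
  by rewrite b0 ge_min (ltW t0)/= le_max bj ?orbT.
by rewrite in_itv/= => sj bs; exists s.
Unshelve. all: by end_near. Qed.

End grid_hitting.

(** * Laplace transform of the Brownian passage time *)

Section fatou_near.
Context {R : realType} {d : measure_display} {T : measurableType d}.
Variable mu : {measure set T -> \bar R}.
Local Open Scope ereal_scope.

(** Fatou's lemma, where the rank from which [g <= f n] may depend on the point. *)
Lemma ge0_le_integral_near (f : nat -> T -> \bar R) (g : T -> \bar R) (C : \bar R) :
    (forall n, measurable_fun setT (f n)) -> (forall n w, 0 <= f n w) ->
    measurable_fun setT g -> (forall w, 0 <= g w) ->
    (forall w, \forall n \near \oo, g w <= f n w) ->
    (forall n, \int[mu]_w f n w <= C) ->
  \int[mu]_w g w <= C.
Proof.
move=> mf f0 mg g0 gf fC.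
apply: (@le_trans _ _ (\int[mu]_w limn_einf (f^~ w))).
  apply: ge0_le_integral => //.
    rewrite /limn_einf; apply: measurableT_comp => //.
    by apply: measurable_fun_limn_esup => n; exact: measurableT_comp.
  move=> w _; rewrite limn_einf_lim; apply: lime_ge; first exact: is_cvg_einfs.
  near=> n; apply: le_ereal_inf_tmp => _ [k /= nk <-].
  move: k nk; near: n; have [N _ HN] := gf w.
  by exists N => // n /= Nn k nk; apply: HN; exact: leq_trans nk.
apply: le_trans (fatou mu measurableT mf _) _ => //.
rewrite limn_einf_lim; apply: lime_le; first exact: is_cvg_einfs.
near=> n; apply: le_trans (fC n); apply: ereal_inf_lbound.
by exists n => //=.
Unshelve. all: by end_near. Qed.

End fatou_near.

Section laplace_weight.
Context {R : realType}.

(** The value [0] at [+oo] is the limit of [exp (- l * s)], so paths that never reach the level do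
    not contribute. *)
Definition laplace_weight (l : R) (x : \bar R) : R :=
  if x is s%:E then expR (- l * s) else 0.

Lemma laplace_weight_ge0 l x : 0 <= laplace_weight l x.
Proof. by case: x => //= s; exact: expR_ge0. Qed.

Lemma laplace_weight_le1 l x : 0 <= l -> (0 <= x)%E -> laplace_weight l x <= 1.
Proof.
move=> l0; case: x => //= s s0; rewrite -expR0 ler_expR mulNr oppr_le0.
by rewrite mulr_ge0.
Qed.

Lemma measurable_laplace_weight l :
  measurable_fun setT (laplace_weight l).
Proof.
rewrite (_ : laplace_weight l =
    (fun x => expR (- l * fine x) * \1_(range (@EFin R)) x)).
  apply: measurable_funM.
    apply: measurableT_comp => //.
    exact: measurable_funM.
  have mE : measurable (range (@EFin R)).
    by apply: measurable_image_EFin; exact: (@measurableT _ R).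
  exact: measurable_indic.
apply/funext => -[s| |]; rewrite indicE /=.
- by rewrite mem_set ?mulr1//; exists s.
- by rewrite memNset ?mulr0// => -[].
- by rewrite memNset ?mulr0// => -[].
Qed.

End laplace_weight.

Section passage_laplace.
Context {R : realType} {d : measure_display} {T : measurableType d}.
Context {P : probability T R} (B : R -> {RV P >-> R}).
Hypothesis brownB : standard_brownian_motion P B.

(* [B 0 = 0] holds only almost surely, and paths are continuous only on
   [[0, +oo[]; this version has both properties everywhere. *)
Let b (w : T) (s : R) : R := B (Num.max 0 s) w - B 0 w.

Let cb w : continuous (b w).
Proof.
have [_ cB _ _] := brownB; move=> s.
apply: (@cvgB _ R^o); last exact: cvg_cst.
exact: (continuous_max0_path (cB w)).
Qed.

Let b0 w : b w 0 = 0.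
Proof. by rewrite /b maxxx subrr. Qed.

Let hit (a h : R) (m : nat) (w : T) : R := (grid_hit (b w) a h m)%:R * h.

Let stopped (th a h : R) (m : nat) (w : T) : R :=
  expR (th * b w (hit a h m w) - th ^+ 2 / 2 * hit a h m w).

Let stoppedE th a h m w : 0 < h -> stopped th a h m w =
  exp_walk (grid_increment B h) th (th ^+ 2 / 2 * h)
    (walk_hit (grid_increment B h) a m w) w.
Proof.
move=> h0; have bE j : b w (j%:R * h) = walk (grid_increment B h) j w.
  by rewrite walk_grid_increment /b max_r// mulr_ge0// ltW.
have hE : grid_hit (b w) a h m = walk_hit (grid_increment B h) a m w.
  by apply: eq_find => j; rewrite bE.
by rewrite /stopped /hit hE bE /exp_walk; congr (expR (_ - _)); ring.
Qed.

Let measurable_stopped th a h m : 0 < h ->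
  measurable_fun setT (stopped th a h m).
Proof.
move=> h0; have /funext-> := fun w => stoppedE th a m w h0.
by apply: measurable_exp_walk_hit => i; exact: measurable_funB.
Qed.

Let integral_stopped th a h m : 0 < h ->
  (\int[P]_w (stopped th a h m w)%:E = 1)%E.
Proof.
move=> h0; under eq_integral do rewrite stoppedE//.
exact: integral_grid_hit.
Qed.

Let tau (t : R) (w : T) : \bar R := first_passage_time (fun s w => b w s) t w.

Let measurable_tau t : measurable_fun setT (tau t).
Proof.
apply: measurable_first_passage_time => [s s0|w].
  by apply: measurable_funB.
exact/continuous_subspaceT/cb.
Qed.

Let L (l t : R) : R := fine (\int[P]_w (laplace_weight l (tau t w))%:E)%E.

Let measurable_weight l t : measurable_fun setT (fun w => laplace_weight l (tau t w)).
Proof. exact: (measurableT_comp (measurable_laplace_weight l)). Qed.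

Let LE l t : 0 <= l ->
  (\int[P]_w (laplace_weight l (tau t w))%:E)%E = (L l t)%:E.
Proof.
move=> l0; rewrite /L fineK// ge0_fin_numE; last first.
  by apply: integral_ge0 => w _; rewrite lee_fin laplace_weight_ge0.
apply: (@le_lt_trans _ _ (\int[P]_w (cst 1 w))%E); last first.
  by rewrite integral_cst//= [X in (_ * X)%E]probability_setT mule1 ltry.
apply: ge0_le_integral => //.
- by move=> w _; rewrite lee_fin laplace_weight_ge0.
- exact/measurable_EFinP.
- move=> w _; rewrite lee_fin laplace_weight_le1//.
  exact: first_passage_time_ge0.
Qed.

Let L_ge0 l t : 0 <= L l t.
Proof.
by rewrite fine_ge0// integral_ge0// => w _; rewrite lee_fin laplace_weight_ge0.
Qed.

(** Stop at a level [a < t]: on a fine grid this happens before [tau + e], so the stopped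
    martingale, of mean [1], eventually dominates the left-hand integrand. Fatou's lemma
    concludes. *)
Let upper_step (th a t e : R) : 0 < th -> a < t -> 0 < e ->
  expR (th * a - th ^+ 2 / 2 * e) * L (th ^+ 2 / 2) t <= 1.
Proof.
move=> th0 ta e0; set l := th ^+ 2 / 2; set c := expR _.
have l0 : 0 < l by rewrite divr_gt0// exprn_gt0.
rewrite -lee_fin EFinM -LE ?(ltW l0)// -ge0_integralZl//; last 3 first.
- exact/measurable_EFinP.
- by move=> w _; rewrite lee_fin laplace_weight_ge0.
- by rewrite lee_fin expR_ge0.
apply: (@ge0_le_integral_near _ _ _ P
  (fun n w => (stopped th a n.+1%:R^-1 (n.+1 ^ 2) w)%:E)).
- by move=> n; apply/measurable_EFinP/measurable_stopped; rewrite invr_gt0.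
- by move=> n w; rewrite lee_fin expR_ge0.
- by apply/measurable_EFinP; exact: measurable_funM.
- by move=> w; rewrite mule_ge0// lee_fin ?expR_ge0// laplace_weight_ge0.
- move=> w; rewrite /laplace_weight; case E : (tau t w) => [r| |]; last 2 first.
  + by near=> n; rewrite mule0 lee_fin expR_ge0.
  + by near=> n; rewrite mule0 lee_fin expR_ge0.
  have : (tau t w < (r + e)%:E)%E by rewrite E lte_fin ltrDl.
  move=> /first_passage_time_ltP[s /andP[s0 sre] bs].
  have e'0 : 0 < r + e - s by rewrite subr_gt0.
  near=> n; rewrite -EFinM lee_fin -expRD ler_expR.
  have [] : let j := (grid_hit (b w) a n.+1%:R^-1 (n.+1 ^ 2))%:R / n.+1%:R in
     a <= b w j /\ j <= s + (r + e - s).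
    by near: n; exact: (grid_hit_after (@cb w) s0 bs ta e'0).
  rewrite [s + _]addrC subrK -/(hit a n.+1%:R^-1 (n.+1 ^ 2) w) => aj jr.
  rewrite mulNr -addrA -opprD -mulrDr [e + r]addrC.
  by rewrite lerB ?ler_pM2l.
- by move=> n; rewrite integral_stopped// invr_gt0.
Unshelve. all: by end_near. Qed.

(* The overshoot above [t] is not bounded uniformly in the grid, so Fatou's lemma is
   applied to [f] truncated at [A]; the loss is controlled by the second moment
   through [f <= min (f, A) + f ^ 2 / A]. *)
Let lower_step (th t e A : R) (K : nat) : 0 < th -> 0 < t -> 0 < e ->
    (0 < K)%N -> expR (th * (t + e)) * 2 <= A ->
  1 <= expR (th * (t + e)) * (L (th ^+ 2 / 2) t + expR (- (th ^+ 2 / 2) * K%:R))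
       + expR (th ^+ 2 * K%:R) / A.
Proof.
move=> th0 t0 e0 K0; set l := th ^+ 2 / 2; set c := expR _ => cA.
have l0 : 0 < l by rewrite divr_gt0// exprn_gt0.
have c0 : 0 < c by exact: expR_gt0.
have A0 : 0 < A by rewrite (lt_le_trans _ cA)// mulr_gt0.
set q := expR (- l * K%:R).
have q1 : q <= 1 by rewrite -expR0 ler_expR mulNr oppr_le0 mulr_ge0// ltW.
pose Y w := c * (laplace_weight l (tau t w) + q).
have mY : measurable_fun setT Y.
  by apply: measurable_funM => //; exact: measurable_funD.
have Y0 w : 0 <= Y w.
  by rewrite mulr_ge0 ?(ltW c0)// addr_ge0 ?laplace_weight_ge0 ?expR_ge0.
(* The factor [2] in the hypothesis on [A] covers the two summands of [Y], each at most [c]. *)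
have YA w : Y w <= A.
  rewrite (le_trans _ cA)// ler_wpM2l ?(ltW c0)// -[2]/(1 + 1) lerD//.
  by rewrite laplace_weight_le1 ?(ltW l0)//; exact: first_passage_time_ge0.
have intY : (\int[P]_w (Y w)%:E = (c * (L l t + q))%:E)%E.
  under eq_integral do rewrite EFinM EFinD.
  rewrite ge0_integralZl//; last 3 first.
  - by apply/measurable_EFinP; exact: measurable_funD.
  - by move=> w _; rewrite adde_ge0// lee_fin ?laplace_weight_ge0 ?expR_ge0.
  - by rewrite lee_fin ltW.
  rewrite ge0_integralD//; last 3 first.
  - by move=> w _; rewrite lee_fin laplace_weight_ge0.
  - exact/measurable_EFinP.
  - by move=> w _; rewrite lee_fin expR_ge0.
  rewrite LE ?(ltW l0)// integral_cst//= [X in (_ + _ * X)%E]probability_setT.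
  by rewrite mule1 -EFinD -EFinM.
have intAY : (\int[P]_w (A - Y w)%:E = (A - c * (L l t + q))%:E)%E.
  have : (\int[P]_w (A - Y w)%:E + \int[P]_w (Y w)%:E = A%:E)%E.
    rewrite -ge0_integralD//; last 4 first.
    - by move=> w _; rewrite lee_fin subr_ge0.
    - by apply/measurable_EFinP; exact: measurable_funB.
    - by move=> w _; rewrite lee_fin.
    - exact/measurable_EFinP.
    under eq_integral do rewrite -EFinD subrK.
    by rewrite integral_cst//= [X in (_ * X)%E]probability_setT mule1.
  rewrite intY => H.
  by rewrite -[LHS](@addeK _ (c * (L l t + q))%:E)// H -EFinB.
pose D := expR (th ^+ 2 * K%:R) / A.
pose f n w := stopped th t n.+1%:R^-1 (K * n.+1) w.
have mf n : measurable_fun setT (f n).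
  by apply: measurable_stopped; rewrite invr_gt0.
have f0 n w : 0 <= f n w by exact: expR_ge0.
have mg n : measurable_fun setT (fun w => A - Num.min (f n w) A).
  by apply: measurable_funB => //; exact: measurable_minr.
have g0 n w : 0 <= A - Num.min (f n w) A by rewrite subr_ge0 ge_min lexx orbT.
rewrite -/D.
(* Subtracting from [A] turns the lower bound sought into an upper bound, the form that Fatou's
   lemma provides. *)
suff : A - c * (L l t + q) <= A + D - 1 by lra.
rewrite -lee_fin -intAY.
apply: (@ge0_le_integral_near _ _ _ P (fun n w => (A - Num.min (f n w) A)%:E)).
- by move=> n; exact/measurable_EFinP.
- by move=> n w; rewrite lee_fin.
- by apply/measurable_EFinP; exact: measurable_funB.
- by move=> w; rewrite lee_fin subr_ge0.
- move=> w; have [N _ HN] := grid_hit_before_level (@cb w) (b0 w) t0 e0 K0.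
  exists N => // n /= Nn; have /= [] := HN n Nn.
  rewrite -/(hit t n.+1%:R^-1 (K * n.+1) w) => bj hj.
  rewrite lee_fin lerB// ge_min; apply/orP; left.
  rewrite /f /stopped -/l expRD; set j := hit _ _ _ _ in bj hj *.
  apply: (@le_trans _ _ (c * expR (- l * j))).
    by rewrite mulNr ler_wpM2r ?expR_ge0// ler_expR ler_wpM2l// ltW.
  (* Stopping at the horizon [K] produces the term [q]; otherwise the passage occurs no later than
     [j], and the weight of [tau] suffices. *)
  rewrite ler_wpM2l ?(ltW c0)//; case: hj => [->|[s /andP[s0 sj] bs]].
    by rewrite lerDr laplace_weight_ge0.
  have : (tau t w <= s%:E)%E by apply: ereal_inf_lbound; exists s.
  have := first_passage_time_ge0 (fun s w => b w s) t w; rewrite -/(tau t w).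
  case: (tau t w) => [r| |]//=; rewrite !lee_fin => r0 rs.
  rewrite -[leLHS]addr0 lerD ?expR_ge0// ler_expR !mulNr lerN2.
  by rewrite ler_wpM2l ?(ltW l0)// (le_trans rs).
move=> n; have h0 : 0 < n.+1%:R^-1 :> R by rewrite invr_gt0.
have : (\int[P]_w (A - Num.min (f n w) A)%:E + \int[P]_w (f n w)%:E <=
    (A + D)%:E)%E.
  rewrite -ge0_integralD//; last 4 first.
  - by move=> w _; rewrite lee_fin.
  - exact/measurable_EFinP.
  - by move=> w _; rewrite lee_fin.
  - exact/measurable_EFinP.
  have -> : ((A + D)%:E = \int[P]_w (A + D * stopped (2 * th) t n.+1%:R^-1 (K * n.+1) w)%:E)%E.
    under eq_integral do rewrite EFinD EFinM.
    rewrite ge0_integralD//; last 3 first.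
    - by move=> w _; rewrite lee_fin ltW.
    - by move=> w _; rewrite -EFinM lee_fin mulr_ge0 ?expR_ge0// divr_ge0 ?expR_ge0// ltW.
    - apply/measurable_EFinP/measurable_funM => //; exact: measurable_stopped.
    rewrite ge0_integralZl//; last 3 first.
    - by apply/measurable_EFinP; exact: measurable_stopped.
    - by move=> w _; rewrite lee_fin expR_ge0.
    - by rewrite lee_fin divr_ge0 ?expR_ge0// ltW.
    rewrite integral_stopped// mule1 integral_cst//=.
    by rewrite [X in (_ * X + _)%E]probability_setT mule1 -EFinD.
  apply: ge0_le_integral => //.
  - by move=> w _; rewrite -EFinD lee_fin addr_ge0.
  - by apply/measurable_EFinP; exact: measurable_funD.
  - apply/measurable_EFinP; apply: measurable_funD => //; apply: measurable_funM => //.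
    exact: measurable_stopped.
  move=> w _; rewrite -EFinD lee_fin.
  apply: (@le_trans _ _ (A + f n w ^+ 2 / A)).
    have [fA|Af] := leP (f n w) A; first by rewrite subrK lerDl divr_ge0// ?sqr_ge0// ltW.
    rewrite subrr add0r expr2 -mulrA ler_wpDl ?(ltW A0)// ler_peMr//.
    by rewrite ler_pdivlMr// mul1r ltW.
  (* The square of [f] is the stopped martingale of parameter [2 * th] times [exp (th^2 * j)], and
     [j <= K]. *)
  rewrite lerD2l /D [leRHS]mulrAC ler_wpM2r ?invr_ge0 ?(ltW A0)//.
  rewrite /f /stopped expr2 -!expRD ler_expR.
  set j := hit _ _ _ _; rewrite (_ : (2 * th) ^+ 2 / 2 = 2 * th ^+ 2); last by field.
  have jK : j <= K%:R.
    rewrite /j /hit ler_pdivrMr// -natrM ler_nat; exact: grid_hit_le.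
  have : th ^+ 2 * j <= th ^+ 2 * K%:R by rewrite ler_wpM2l ?sqr_ge0.
  move=> jKth; rewrite -subr_ge0.
  rewrite (_ : _ - _ = th ^+ 2 * K%:R - th ^+ 2 * j) ?subr_ge0//.
  by field.
rewrite integral_stopped// => H.
by rewrite -(leeD2rE _ _ (x := 1%E))// -EFinD subrK.
Qed.

Let L_le th t : 0 < th -> 0 < t -> L (th ^+ 2 / 2) t <= expR (- th * t).
Proof.
move=> th0 t0; rewrite leNgt; apply/negP => lt.
have L0 : 0 < L (th ^+ 2 / 2) t by rewrite (lt_trans _ lt)// expR_gt0.
(* The logarithmic excess [e] is spent partly on the level, [e / 2], and partly on the time,
   [e / 4]; the remaining [e / 4 > 0] contradicts [upper_step]. *)
pose e := ln (L (th ^+ 2 / 2) t) + th * t.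
have e0 : 0 < e.
  by rewrite -ltrBlDr sub0r -mulNr -(expRK (- th * t)) ltr_ln ?posrE ?expR_gt0.
have d0 : 0 < e / (2 * th ^+ 2) by rewrite divr_gt0// mulr_gt0// exprn_gt0.
have ta : t - e / (2 * th) < t by rewrite gtrDl oppr_lt0 divr_gt0// mulr_gt0.
have := upper_step th0 ta d0; apply/negP; rewrite -ltNge.
have lnL : ln (L (th ^+ 2 / 2) t) = e - th * t by rewrite addrK.
rewrite -[X in _ * X]lnK ?posrE// -expRD -[ltLHS]expR0 ltr_expR lnL.
rewrite [ltRHS](_ : _ = e / 4) ?divr_gt0//.
by field; rewrite gt_eqF.
Qed.

Let L_ge th t : 0 < th -> 0 < t -> expR (- th * t) <= L (th ^+ 2 / 2) t.
Proof.
move=> th0 t0; set l := th ^+ 2 / 2.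
have l0 : 0 < l by rewrite divr_gt0// exprn_gt0.
rewrite leNgt; apply/negP => lt.
(* A deficit [q < 1] is refuted by choosing [e], then [K], then [A], so that [lower_step] reads [1
   <= 2 / (1 + q) * (q + (1 - q) / 4) + (1 - q) / 8], which is false. *)
pose q := L l t * expR (th * t).
have q1 : q < 1.
  by rewrite /q -ltr_pdivlMr ?expR_gt0// mul1r -expRN -mulNr.
have q0 : 0 <= q by rewrite mulr_ge0 ?expR_ge0.
pose e := - ln ((1 + q) / 2) / th.
have e0 : 0 < e.
  by rewrite divr_gt0// oppr_gt0 ln_lt0//; apply/andP; split; lra.
have the : expR (th * e) = 2 / (1 + q).
  rewrite /e mulrC divfK ?gt_eqF// expRN lnK ?invf_div//.
  by rewrite posrE; lra.
pose u := - ln ((1 - q) / 4 / expR (th * t)) / l.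
pose K := (Num.truncn u).+1.
have uK : u < K%:R by exact: truncnS_gt.
have EK : expR (- l * K%:R) * expR (th * t) < (1 - q) / 4.
  rewrite -ltr_pdivlMr ?expR_gt0//.
  have v0 : 0 < (1 - q) / 4 / expR (th * t).
    by rewrite divr_gt0 ?expR_gt0//; lra.
  rewrite -[ltRHS]lnK ?posrE// ltr_expR mulNr ltrNl -ltr_pdivrMl//.
  by rewrite mulrC.
pose A := Num.max (expR (th * (t + e)) * 2) (expR (th ^+ 2 * K%:R) * 8 / (1 - q)).
have A1 : expR (th * (t + e)) * 2 <= A by rewrite le_max lexx.
have A2 : expR (th ^+ 2 * K%:R) / A <= (1 - q) / 8.
  have A0 : 0 < A by rewrite (lt_le_trans _ A1)// mulr_gt0 ?expR_gt0.
  have q8 : 0 < (1 - q) / 8 by lra.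
  rewrite ler_pdivrMr// [leRHS]mulrC -ler_pdivrMr//.
  by rewrite invf_div mulrA le_max lexx orbT.
have := lower_step th0 t0 e0 (ltn0Sn _ : (0 < K)%N) A1.
rewrite [th * (t + e)]mulrDr expRD the -/l => H.
have : 1 <= 2 / (1 + q) * (q + (1 - q) / 4) + (1 - q) / 8.
  apply: (le_trans H); apply: lerD => //.
  rewrite [expR (th * t) * _]mulrC -[leLHS]mulrA ler_wpM2l//.
    by rewrite divr_ge0//; lra.
  by rewrite mulrC mulrDl lerD// ltW.
apply/negP; rewrite -ltNge -subr_gt0.
rewrite (_ : _ - _ = (1 - q) * (3 - q) / (8 * (1 + q))); last first.
  by field; rewrite gt_eqF//; lra.
by rewrite divr_gt0// mulr_gt0//; lra.
Qed.

Lemma measurable_brownian_passage t :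
  measurable_fun setT (first_passage_time (fun s => B s : T -> R) t).
Proof.
by have [_ cB _ _] := brownB; apply: measurable_first_passage_time.
Qed.

Lemma integral_laplace_passage l t : 0 < l -> 0 < t ->
  (\int[P]_w (laplace_weight l
     (first_passage_time (fun s => B s : T -> R) t w))%:E =
   (expR (- t * Num.sqrt (2 * l)))%:E)%E.
Proof.
move=> l0 t0; pose th := Num.sqrt (2 * l).
have th0 : 0 < th by rewrite sqrtr_gt0 mulr_gt0.
have thl : th ^+ 2 / 2 = l.
  by rewrite sqr_sqrtr ?mulr_ge0 ?(ltW l0)// mulrC mulKf.
have -> : - t * Num.sqrt (2 * l) = - th * t by rewrite -/th; ring.
transitivity (L l t)%:E; last first.
  by congr EFin; apply/eqP; rewrite eq_le -thl L_le// L_ge.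
rewrite -LE ?(ltW l0)//; have [B00 _ _ _] := brownB.
(* Where [B 0 = 0], the passage times of the path and of its modification [b] coincide. *)
apply: ge0_ae_eq_integral => //.
- apply/measurable_EFinP.
  apply: (measurableT_comp (measurable_laplace_weight l)).
  exact: measurable_brownian_passage.
- exact/measurable_EFinP.
- by move=> w _; rewrite lee_fin laplace_weight_ge0.
- by move=> w _; rewrite lee_fin laplace_weight_ge0.
apply: filterS B00 => w Bw0 _; congr (laplace_weight l _)%:E.
congr (ereal_inf (image _ _)); apply/seteqP; split=> s /= [s0 bs]; split=> //.
- by rewrite /b max_r// Bw0 subr0.
- by move: bs; rewrite /b max_r// Bw0 subr0.
Qed.

Lemma brownian_passage_infinite t : 0 < t ->
  P [set w | first_passage_time (fun s => B s : T -> R) t w = +oo%E] = 0%E.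
Proof.
move=> t0; set F := [set w | _].
have mF : measurable F.
  have := @measurable_brownian_passage t measurableT _ (emeasurable_set1 +oo%E).
  by rewrite setTI.
have P1 l : 0 < l -> ((expR (- t * Num.sqrt (2 * l)))%:E <= P (~` F))%E.
  move=> l0; rewrite -integral_laplace_passage//.
  have -> : P (~` F) = (\int[P]_w (\1_(~` F) w)%:E)%E.
    by rewrite integral_indic// ?setIT//; exact: measurableC.
  apply: ge0_le_integral => //.
  - by move=> w _; rewrite lee_fin laplace_weight_ge0.
  - apply/measurable_EFinP.
    apply: (measurableT_comp (measurable_laplace_weight l)).
    exact: measurable_brownian_passage.
  - by apply/measurable_EFinP/measurable_indic; exact: measurableC.
  move=> w _; rewrite lee_fin indicE; have [wF|wF] := boolP (w \in ~` F).
    rewrite laplace_weight_le1 ?(ltW l0)//; exact: first_passage_time_ge0.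
  have : F w by apply: contrapT => H; move/negP: wF; apply; exact/mem_set.
  by rewrite /F/= => ->.
have PF : P F = (1 - P (~` F))%E.
  by rewrite -probability_setC ?setCK//; exact: measurableC.
have PCfin : P (~` F) \is a fin_num by apply: fin_num_measure; exact: measurableC.
have PC1 : (1 <= P (~` F))%E.
  rewrite -(fineK PCfin) lee_fin; apply/ler_addgt0Pl => e e0.
  (* This value of [l] makes [t * sqrt (2 * l)] equal to [e], and [exp (- e) >= 1 - e]. *)
  have x0 : 0 < (e / t) ^+ 2 / 2 by rewrite divr_gt0// exprn_gt0// divr_gt0.
  have := P1 _ x0; rewrite -(fineK PCfin) lee_fin.
  rewrite [2 * _]mulrC mulfVK// sqrtr_sqr ger0_norm ?divr_ge0 ?(ltW e0) ?(ltW t0)//.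
  rewrite mulNr mulrCA mulfV ?gt_eqF// mulr1.
  have := expR_ge1Dx (- e); lra.
apply/eqP; rewrite eq_le measure_ge0 andbT PF.
by rewrite leeBlDr// add0e.
Qed.

End passage_laplace.

(** * The time-changed birth process *)

Section divergent_product.
Context {R : realType} (lam : nat -> R).
Hypothesis lam_gt0 : forall k, (0 < k)%N -> 0 < lam k.
Hypothesis lam_series : (\sum_(1 <= k <oo) ((lam k)^-1)%:E = +oo)%E.

Lemma birth_product_small (e : R) : 0 < e ->
  exists k, \prod_(1 <= j < k.+1) (lam j / (1 + lam j)) < e.
Proof.
move=> e0; have [k ks] : exists k, e^-1 < \sum_(1 <= j < k.+1) (lam j)^-1.
  apply: contrapT => H.
  have : (\sum_(1 <= k <oo) ((lam k)^-1)%:E <= (e^-1)%:E)%E.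
    apply: lime_le.
      by apply: is_cvg_nneseries => n n0 _; rewrite lee_fin invr_ge0 ltW ?lam_gt0.
    near=> n; rewrite sumEFin lee_fin leNgt; apply/negP => ne; apply: H.
    by exists n.-1; rewrite prednK//; near: n; exact: nbhs_infty_gt.
  by rewrite lam_series leye_eq.
exists k; pose a := \prod_(1 <= j < k.+1) (lam j / (1 + lam j)).
(* Equivalent to bounding the product of the [1 + 1 / lam j] below by [1] plus the sum of the
   [1 / lam j]. *)
suff : 0 < a /\ a * (1 + \sum_(1 <= j < k.+1) (lam j)^-1) <= 1.
  move=> [a0 H]; rewrite -(ltr_pM2r (_ : 0 < e^-1)) ?invr_gt0// divff ?gt_eqF//.
  by rewrite (lt_le_trans _ H)// ltr_pM2l// (lt_trans ks)// ltrDr.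
rewrite /a; elim: k {a ks} => [|k [IH1 IH2]].
  by rewrite !big_geq// addr0 mulr1.
rewrite big_nat_recr//= [\sum_(_ <= _ < _) _]big_nat_recr//=.
have l0 := lam_gt0 (ltn0Sn k).
set p := \prod_(_ <= _ < _) _ in IH1 IH2 *; set s := \sum_(_ <= _ < _) _ in IH2 *.
have s0 : 0 <= s.
  by rewrite /s big_nat_cond sumr_ge0// => j /andP[/andP[j0 _] _];
    rewrite invr_ge0 ltW ?lam_gt0.
have l1 : 0 < 1 + lam k.+1 by rewrite addr_gt0.
split; first by apply: mulr_gt0 => //; exact: divr_gt0.
have p1 : p <= 1.
  by apply: le_trans IH2; rewrite ler_peMr ?(ltW IH1)// lerDl.
rewrite (_ : _ * _ = (p * (1 + s) * lam k.+1 + p) / (1 + lam k.+1)); last first.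
  by field; rewrite !gt_eqF// addr_gt0.
rewrite ler_pdivrMr ?addr_gt0// mul1r addrC lerD//.
by rewrite -[leRHS]mul1r ler_wpM2r// ltW.
Unshelve. all: by end_near. Qed.

End divergent_product.

Section time_changed_birth.
Context {R : realType} {d : measure_display} {T : measurableType d}.
Context {P : probability T R} (lam : nat -> R) (N : R -> T -> \bar R)
  (B : R -> {RV P >-> R}) (W : nat -> {RV P >-> R}).
Hypothesis lam_gt0 : forall k, (0 < k)%N -> 0 < lam k.
Hypothesis lam_inj : forall j k : nat, (0 < j)%N -> (0 < k)%N -> j <> k ->
  lam j <> lam k.
Hypothesis lam_series : (\sum_(1 <= k <oo) ((lam k)^-1)%:E = +oo)%E.
Hypothesis distW : forall (k : nat) (A : set R), (0 < k)%N -> measurable A ->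
  distribution P (W k) A = exponential_prob (lam k) A.
Hypothesis indepW : mutually_independent P (fun k => W k.+1 : T -> R).
Hypothesis W_gt0 : forall (k : nat) w, (0 < k)%N -> 0 < W k w.
Hypothesis N_fin : forall (k : nat) (s : R) w, (0 < k)%N ->
  \sum_(1 <= j < k) W j w <= s < \sum_(1 <= j < k.+1) W j w ->
  N s w = (k%:R)%:E.
Hypothesis N_inf : forall (s : R) w,
  (forall k : nat, \sum_(1 <= j < k) W j w <= s) -> N s w = +oo%E.
Hypothesis brownB : standard_brownian_motion P B.
Hypothesis indepNB : independent_processes P N (fun s => B s : T -> R).

Let S := jump_time W.

Let S0 w : S 0 w = 0. Proof. exact: jump_time0. Qed.
Let S_homo w : {homo S ^~ w : j k / (j <= k)%N >-> j <= k}.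
Proof. exact: jump_time_homo. Qed.
Let mS k : measurable_fun setT (S k). Proof. exact: measurable_jump_time. Qed.

Let N_cases s w : 0 <= s ->
  (exists2 k, S k w <= s < S k.+1 w & N s w = (k.+1%:R)%:E) \/
  ((forall k, S k w <= s) /\ N s w = +oo%E).
Proof.
move=> s0; have [[k sk]|H] := pselect (exists k, s < S k w).
  left; have [j sj jmin] := ex_minnP (ex_intro (fun k => s < S k w) k sk).
  case: j => [|j] in sj jmin *; first by move: sj; rewrite S0 ltNge s0.
  have Sj : S j w <= s.
    by rewrite leNgt; apply/negP => /jmin; rewrite ltnn.
  by exists j; rewrite ?Sj ?sj//; apply: N_fin => //; apply/andP; split.
have Sle k : S k w <= s by rewrite leNgt; apply/negP => sk; apply: H; exists k.
right; split=> //; apply: N_inf => -[|k]; last exact: Sle.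
by rewrite big_geq.
Qed.

(** Expresses jump times through values of [N], so that independence, assumed for [N], carries over
    to them. *)
Let S_gt_N k s w : 0 <= s -> (S k w <= s) = ((k%:R)%:E < N s w)%E.
Proof.
move=> /(N_cases w)[[j /andP[js sj] ->]|[-> ->]]; last by rewrite ltry.
rewrite lte_fin ltr_nat ltnS; apply/idP/idP => [ks|kj].
  rewrite leqNgt; apply/negP => jk.
  by have := lt_le_trans sj (le_trans (S_homo w jk) ks); rewrite ltxx.
exact: le_trans (S_homo w kj) js.
Qed.

Let gensN := [set N s @^-1` A | s in [set s : R | 0 <= s] & A in measurable].

Let measurable_S_sigma k :
  measurable_fun setT (S k : g_sigma_algebraType gensN -> R).
Proof.
apply: (measurability _ (RGenOInfty.measurableE R)) => //.
move=> _ [_ [x ->] <-]; rewrite setTI.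
have [x0|x0] := ltP x 0.
  rewrite (_ : _ @^-1` _ = setT); first exact: measurableT.
  apply/seteqP; split=> // w _; rewrite /= in_itv/= andbT (lt_le_trans x0)//.
  exact: jump_time_ge0.
rewrite (_ : _ @^-1` _ = ~` (N x @^-1` `](k%:R)%:E, +oo[)).
  apply: measurableC; apply: sub_sigma_algebra; exists x => //.
  by exists `](k%:R)%:E, +oo[%classic => //; exact: emeasurable_itv.
apply/seteqP; split=> w /=; rewrite !in_itv/= !andbT -S_gt_N// ltNge.
  by move/negP.
by move=> H; apply/negP.
Qed.

Section at_level.
Variable t : R.
Hypothesis t0 : 0 < t.

Let tau : T -> \bar R := first_passage_time (fun s => B s : T -> R) t.

Let tau_ge0 w : (0 <= tau w)%E.
Proof. exact: first_passage_time_ge0. Qed.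

Let mtau : measurable_fun setT tau.
Proof. exact: measurable_brownian_passage. Qed.

(** Measurability of passage times is applied with the sigma-algebra generated by [B] as the ambient
    one. *)
Let sigma_tau A : measurable A ->
  process_sigma (fun s => B s : T -> R) (tau @^-1` A).
Proof.
move=> mA; have [_ cB _ _] := brownB.
pose gensB := [set (B s : T -> R) @^-1` A | s in [set s : R | 0 <= s] & A in measurable].
have mB s : 0 <= s -> measurable_fun setT (B s : g_sigma_algebraType gensB -> R).
  move=> s0 _ A' mA'; rewrite setTI; apply: sub_sigma_algebra.
  by exists s => //; exists A'.
have := @measurable_first_passage_time _ _ (g_sigma_algebraType gensB)
  (fun s => B s : T -> R) mB cB t.
by move=> /(_ measurableT A mA); rewrite setTI.
Qed.

(** State [k.+1] at the passage time: [k] counts the jumps already made. *)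
Definition occupation (k : nat) : set T :=
  [set w | (S k w)%:E <= tau w < (S k.+1 w)%:E]%E.

Let measurable_occupation k : measurable (occupation k).
Proof.
rewrite (_ : occupation k = [set w | (S k w)%:E <= tau w]%E `&`
                            [set w | tau w < (S k.+1 w)%:E]%E).
  apply: measurableI; rewrite -[X in measurable X]setTI.
    by apply: measurable_lee => //; exact/measurable_EFinP.
  by apply: measurable_lte => //; exact/measurable_EFinP.
by apply/seteqP; split=> w /=; [move/andP|move=> ?; exact/andP].
Qed.

(** Linearity in [e]; the coefficients have both signs, hence integrability rather than
    nonnegativity. *)
Let integral_birth_state_coef k (f : nat -> T -> R) (e : nat -> R) :
    (forall m, (0 < m)%N -> P.-integrable setT (EFin \o f m)) ->
    (forall m, (0 < m)%N -> \int[P]_w (f m w)%:E = (e m)%:E)%E ->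
  (\int[P]_w (birth_state_coef lam k (f ^~ w))%:E =
   (birth_state_coef lam k e)%:E)%E.
Proof.
move=> intf fe; rewrite /birth_state_coef.
pose c m := (\prod_(1 <= l < k.+1 | l != m) (lam l - lam m))^-1.
have sumI n : P.-integrable setT
      (EFin \o (fun w => \sum_(1 <= m < n.+1) f m w * c m)) /\
    (\int[P]_w (\sum_(1 <= m < n.+1) f m w * c m)%:E =
     (\sum_(1 <= m < n.+1) e m * c m)%:E)%E.
  elim: n => [|n [IH1 IH2]].
    rewrite big_geq//; split.
      rewrite (_ : _ \o _ = cst 0%E); first exact: integrable0.
      by apply/funext => w /=; rewrite big_geq.
    by apply: integral0_eq => w _; rewrite big_geq.
  have intn : P.-integrable setT (fun w => (f n.+1 w * c n.+1)%:E).
    under eq_fun do rewrite EFinM.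
    by apply: integrableZr => //; exact: intf.
  split.
    rewrite (_ : _ \o _ = (EFin \o (fun w => (\sum_(1 <= m < n.+1) f m w * c m)%R))
                 \+ (fun w => (f n.+1 w * c n.+1)%R%:E))%E.
      exact: integrableD.
    by apply/funext => w /=; rewrite big_nat_recr//= EFinD.
  under eq_integral do rewrite big_nat_recr//= EFinD.
  rewrite integralD//; rewrite IH2 [in RHS]big_nat_recr//= EFinD; congr (_ + _)%E.
  under eq_integral do rewrite EFinM.
  by rewrite integralZr//; [rewrite fe|exact: intf].
have [sumk intk] := sumI k.
under eq_integral do rewrite EFinM.
by rewrite integralZl// intk.
Qed.

Let integrable_weight m : (0 < m)%N ->
  P.-integrable setT (EFin \o (fun w => laplace_weight (lam m) (tau w))).
Proof.
move=> m0; apply/integrableP; split.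
  apply/measurable_EFinP.
  exact: (measurableT_comp (measurable_laplace_weight _) mtau).
under eq_integral do rewrite /= ger0_norm ?laplace_weight_ge0//.
by rewrite integral_laplace_passage ?lam_gt0// ltry.
Qed.

(** Given [tau = s], independence leaves the probability of state [k.+1] at the fixed time [s];
    integrating it in [s] replaces each exponential by its Laplace transform. *)
Lemma occupation_prob k : P (occupation k) =
  (birth_state_coef lam k.+1 (fun m => expR (- t * Num.sqrt (2 * lam m))))%:E.
Proof.
pose A := [set z : \bar R * (R * R) | (z.2.1)%:E <= z.1 < (z.2.2)%:E]%E.
have mA : measurable A.
  rewrite (_ : A = [set z : \bar R * (R * R) | (z.2.1)%:E <= z.1]%E `&`
                   [set z : \bar R * (R * R) | z.1 < (z.2.2)%:E]%E).
    apply: measurableI; rewrite -[X in measurable X]setTI.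
      apply: measurable_lee => //; apply/measurable_EFinP.
      exact: measurableT_comp.
    apply: measurable_lte => //; apply/measurable_EFinP.
    exact: measurableT_comp.
  by apply/seteqP; split=> w /=; [move/andP|move=> ?; exact/andP].
pose Y w := (S k w, S k.+1 w).
transitivity (\int[P]_w (\1_A (tau w, Y w))%:E)%E.
  transitivity (\int[P]_w (\1_(occupation k) w)%:E)%E.
    by rewrite integral_indic// setIT.
  by apply: eq_integral => w _; rewrite !indicE.
rewrite (ge0_integral_indep (X := tau) (Y := Y)
  (phi := fun z => (\1_A z)%:E))//; last 3 first.
- exact/measurable_fun_pair.
- move=> A' B' mA' mB'; rewrite setIC muleC; apply: indepNB; last exact: sigma_tau.
  have mY : measurable_fun setT (Y : g_sigma_algebraType gensN -> R * R).
    by apply/measurable_fun_pair; exact: measurable_S_sigma.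
  by have := mY measurableT _ mB'; rewrite setTI.
- exact/measurable_EFinP/measurable_indic.
rewrite -(integral_birth_state_coef _ integrable_weight); last first.
  by move=> m m0; rewrite integral_laplace_passage ?lam_gt0.
apply: eq_integral => w' _.
have := tau_ge0 w'; case E : (tau w') => [s| |]// s0.
- rewrite /laplace_weight/= -(birth_state_prob lam_gt0 lam_inj distW indepW W_gt0)//.
  have mO : measurable [set w | S k w <= s < S k.+1 w].
    rewrite (_ : [set w | _] = (S k @^-1` `]-oo, s]) `&` (S k.+1 @^-1` `]s, +oo[)).
      by apply: measurableI; rewrite -[X in measurable X]setTI; exact: mS.
    by apply/seteqP; split=> w /=; rewrite !in_itv/= andbT; [move/andP|move=> ?; exact/andP].
  transitivity (\int[P]_w (\1_[set w | S k w <= s < S k.+1 w] w)%:E)%E.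
    by apply: eq_integral => w _; rewrite !indicE /A/Y.
  by rewrite integral_indic// setIT.
(* At [tau = +oo] both sides vanish: all weights are [0], and no state is occupied. *)
- rewrite /birth_state_coef [X in _ * X]big1 ?mulr0; last by move=> m _; rewrite mul0r.
  apply: integral0_eq => w _; rewrite indicE memNset// /A/=.
  by move=> /andP[_]; rewrite ltNge leey.
Qed.

Let e m := expR (- t * Num.sqrt (2 * lam m)).

Let Q k : set T := [set w | (S k w)%:E <= tau w]%E.

Let mQ k : measurable (Q k).
Proof.
rewrite -[X in measurable X]setTI; apply: measurable_lee => //.
exact/measurable_EFinP.
Qed.

Let Q_sub j k : (j <= k)%N -> Q k `<=` Q j.
Proof. by move=> jk w; apply: le_trans; rewrite lee_fin S_homo. Qed.

Lemma survival_prob k :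
  P (Q k) = (1 - \sum_(1 <= j < k.+1) birth_state_coef lam j e)%:E.
Proof.
elim: k => [|k IH].
  rewrite big_geq// subr0 (_ : Q 0 = setT) ?probability_setT//.
  by apply/seteqP; split=> // w _; rewrite /Q/= S0 tau_ge0.
have QU : Q k = occupation k `|` Q k.+1.
  apply/seteqP; split=> w.
    rewrite /Q /occupation/= => Sk; rewrite Sk/=.
    by have [_|_] := leP (S k.+1 w)%:E (tau w); [right|left].
  by case=> [/andP[]//|]; exact: Q_sub.
have dis : occupation k `&` Q k.+1 = set0.
  apply/seteqP; split=> // w [/andP[_ lt] le].
  by have := lt_le_trans lt le; rewrite ltxx.
have : P (Q k) = (P (occupation k) + P (Q k.+1))%E by rewrite QU measureU.
rewrite IH occupation_prob -/e => H.
by rewrite [in RHS]big_nat_recr//= opprD addrA EFinB H [X in (X - _)%E]addeC addeK.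
Qed.

(** No explosion in bounded time: each event has probability at most [exp a] times a product that
    becomes arbitrarily small. *)
Let P_S_bounded (a : R) : 0 <= a -> P (\bigcap_k [set w | S k w <= a]) = 0%E.
Proof.
move=> a0; apply/eqP; rewrite eq_le measure_ge0 andbT.
have mSa k : measurable [set w | S k w <= a].
  rewrite (_ : [set w | _] = (S k @^-1` `]-oo, a])).
    by rewrite -[X in measurable X]setTI; exact: mS.
  by apply/seteqP; split=> w /=; rewrite in_itv.
apply/lee_addgt0Pr => u u0; rewrite add0e.
have ea0 : 0 < u / expR a by rewrite divr_gt0 ?expR_gt0.
have [k kP] := birth_product_small lam_gt0 lam_series ea0.
apply: (@le_trans _ _ (P [set w | S k w <= a])).
  apply: le_measure; rewrite ?inE//; first exact: bigcapT_measurable.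
  by move=> w; exact.
apply: (le_trans (jump_time_bound lam_gt0 lam_inj distW indepW W_gt0 k a0)).
by rewrite lee_fin mulrC -ler_pdivlMr ?expR_gt0// ltW.
Qed.

Lemma survival_cvg0 : P (Q k) @[k --> \oo] --> 0%E.
Proof.
have mI : measurable (\bigcap_k Q k) by exact: bigcapT_measurable.
suff <- : P (\bigcap_k Q k) = 0%E.
  apply: nonincreasing_cvg_mu => //.
  - by rewrite (le_lt_trans (probability_le1 _ _)) ?ltry.
  - by move=> j k jk; apply/subsetPset; exact: Q_sub.
have mSa a k : measurable [set w | S k w <= a].
  rewrite (_ : [set w | _] = (S k @^-1` `]-oo, a])).
    by rewrite -[X in measurable X]setTI; exact: mS.
  by apply/seteqP; split=> w /=; rewrite in_itv.
have mtauoo : measurable [set w | tau w = +oo%E].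
  have := mtau measurableT (emeasurable_set1 +oo%E).
  by rewrite setTI.
apply: measure_negligible => //.
(* Surviving every jump means that [tau] is infinite or that the jump times stay below some
   integer. *)
apply: (@negligibleS _ _ _ P ([set w | tau w = +oo%E] `|`
    \bigcup_a \bigcap_k [set w | S k w <= a%:R])).
  move=> w Qw; case E : (tau w) => [s| |]; [right|by left|].
    exists (Num.truncn s).+1 => // k _ /=; apply: ltW.
    apply: le_lt_trans (truncnS_gt s).
    by have := Qw k I; rewrite /Q/= E lee_fin.
  by have := tau_ge0 w; rewrite E.
apply: negligibleU.
  by apply/negligibleP => //; exact: brownian_passage_infinite.
apply: negligible_bigcup => a; apply/negligibleP.
  exact: bigcapT_measurable.
exact: P_S_bounded.
Qed.

Let Nhat : T -> \bar R := time_changed N tau.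

Let Nhat_cases w :
  (exists2 k, occupation k w & Nhat w = (k.+1%:R)%:E) \/
  ((forall k, Q k w) /\ Nhat w = +oo%E).
Proof.
rewrite /Nhat /time_changed /occupation /Q/=.
have := tau_ge0 w; case: (tau w) => [s| |]//; last by right; split=> // k; exact: leey.
rewrite lee_fin => /(N_cases w)[[k sk Nk]|[sk Nk]]; first by left; exists k.
by right; split=> // k; rewrite lee_fin.
Qed.

Let occupation_Q k w : occupation k w -> forall j, Q j w <-> (j <= k)%N.
Proof.
move=> /andP[Sk kS] j; split=> [Sj|jk].
  rewrite leqNgt; apply/negP => kj.
  by have := lt_le_trans kS (Q_sub kj Sj); rewrite ltxx.
exact: Q_sub jk _ Sk.
Qed.

Lemma time_changed_eqE k : [set w | Nhat w = (k.+1%:R)%:E] = occupation k.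
Proof.
apply/seteqP; split=> w /= => [Nk|kw].
  have [[j jw Nj]|[_ Nw]] := Nhat_cases w; last by move: Nk; rewrite Nw.
  by move: Nk; rewrite Nj => -[] /eqP; rewrite eqr_nat eqSS => /eqP <-.
have [[j jw ->]|[Qw _]] := Nhat_cases w; last first.
  by have := (occupation_Q kw k.+1).1 (Qw _); rewrite ltnn.
congr (_.+1%:R%:E); apply/eqP; rewrite eqn_leq.
apply/andP; split; first by apply/(occupation_Q kw)/(occupation_Q jw).
exact/(occupation_Q jw)/(occupation_Q kw).
Qed.

(** In state [k.+1] exactly [Q 0, ..., Q k] occur; at [+oo] all of them do. This gives the mean as a
    sum of survival probabilities. *)
Lemma time_changed_series w : Nhat w = (\sum_(k <oo) (\1_(Q k) w)%:E)%E.
Proof.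
have ge0 k : (0 <= (\1_(Q k) w)%:E :> \bar R)%E by rewrite lee_fin.
have [[k kw ->]|[Qw ->]] := Nhat_cases w.
  rewrite (@nneseries_split _ _ 0 k.+1)// eseries0 ?adde0; last first.
    move=> j kj _; rewrite indicE memNset// => /(occupation_Q kw).
    by rewrite leqNgt -[(k < j)%N]/(k.+1 <= j)%N -[k.+1]add0n kj.
  rewrite add0n sumEFin; congr EFin.
  rewrite (eq_big_nat _ _ (F2 := fun=> 1)); last first.
    by move=> j jk; rewrite indicE mem_set//; apply/(occupation_Q kw).
  by rewrite big_const_nat subn0 iter_addr_0.
apply/esym/eqyP => r r0.
apply: (@le_trans _ _ (\sum_(0 <= k < (Num.truncn r).+1) (\1_(Q k) w)%:E)%E).
  rewrite sumEFin lee_fin (eq_big_nat _ _ (F2 := fun=> 1)).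
    by rewrite big_const_nat subn0 iter_addr_0 ltW// truncnS_gt.
  by move=> j _; rewrite indicE mem_set.
exact: nneseries_lim_ge.
Qed.

Lemma integral_time_changed : (\int[P]_w Nhat w =
  1 + \sum_(1 <= k <oo)
    (1 - \sum_(1 <= j < k.+1) birth_state_coef lam j e)%R%:E)%E.
Proof.
under eq_integral do rewrite time_changed_series.
have mind k : measurable_fun setT (fun w => (\1_(Q k) w)%:E : \bar R).
  by apply/measurable_EFinP; exact: measurable_indic.
rewrite integral_nneseries//.
have IQ k : (\int[P]_w (\1_(Q k) w)%:E = P (Q k))%E.
  by rewrite integral_indic// setIT.
rewrite (nneseries_recl (P := xpredT)); last 2 first.
- by move=> k _; exact: integral_ge0.
- by [].
(* The term of index [0] is the certain event, whence the leading [1]. *)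
rewrite IQ survival_prob big_geq// subr0; congr (_ + _)%E.
by apply: eq_eseriesr => k _; rewrite IQ survival_prob.
Qed.

Lemma time_changed_total :
  (\sum_(1 <= k <oo) P [set w | Nhat w = (k%:R)%:E] = 1)%E.
Proof.
apply/cvg_lim => //; rewrite -cvg_shiftS/=.
(* The partial sums of the state probabilities are the complements of the survival probabilities. *)
rewrite (_ : (fun _ => _) = (fun k => 1 - P (Q k))%E).
  have : (1 - P (Q k))%E @[k --> \oo] --> (1 - 0)%E.
    by apply: cvgeB => //; [exact: cvg_cst|exact: survival_cvg0].
  by rewrite sube0.
apply/funext => k; rewrite survival_prob -EFinB opprB addrCA subrr addr0.
rewrite -sumEFin; apply: eq_big_nat => j /andP[j0 _].
by rewrite -(prednK j0) time_changed_eqE occupation_prob.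
Qed.

End at_level.
End time_changed_birth.

Theorem theorem2p2 (R : realType) (d : measure_display) (T : measurableType d)
    (P : probability T R) (lambda : nat -> R)
    (N : R -> T -> \bar R) (B : R -> {RV P >-> R})
    (lambda_gt0 : forall k : nat, (0 < k)%N -> 0 < lambda k)
    (lambda_distinct : forall j k : nat, (0 < j)%N -> (0 < k)%N -> j <> k ->
      lambda j <> lambda k)
    (lambda_series : (\sum_(1 <= k <oo) ((lambda k)^-1)%:E = +oo)%E)
    (birthN : pure_birth_process P lambda N)
    (brownB : standard_brownian_motion P B)
    (indepNB : independent_processes P N (fun s => B s : T -> R)) :
  let Nhat (t : R) : T -> \bar R :=
    time_changed N (first_passage_time (fun s => B s : T -> R) t) in
  let phat (k : nat) (t : R) : \bar R :=
    P [set w | Nhat t w = (k%:R)%:E] in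
  forall t : R, 0 < t ->
  [/\ forall k : nat, (1 < k)%N ->
        phat k t =
        ((\prod_(1 <= j < k) lambda j) *
         \sum_(1 <= m < k.+1)
           (expR (- t * Num.sqrt (2 * lambda m)) /
            \prod_(1 <= l < k.+1 | l != m) (lambda l - lambda m)))%:E,
      phat 1%N t = (expR (- t * Num.sqrt (2 * lambda 1%N)))%:E,
      (\int[P]_w Nhat t w =
       1 + \sum_(1 <= k <oo)
         (1 - \sum_(1 <= m < k.+1)
            ((\prod_(1 <= l < k.+1 | l != m)
                (lambda l / (lambda l - lambda m))) *
             expR (- t * Num.sqrt (2 * lambda m))))%R%:E)%E &
      (\sum_(1 <= k <oo) phat k t = 1)%E].
Proof.
case: birthN => W [distW indepW W_gt0 N_fin N_inf] Nhat phat t t0.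
have phatE k : phat k.+1 t = (birth_state_coef lambda k.+1
    (fun m => expR (- t * Num.sqrt (2 * lambda m))))%:E.
  rewrite /phat /Nhat (time_changed_eqE B W_gt0 N_fin N_inf).
  exact: (occupation_prob lambda_gt0 lambda_distinct distW indepW W_gt0 N_fin
    N_inf brownB indepNB).
split.
- by case=> // k _; rewrite phatE.
- rewrite phatE /birth_state_coef big_geq// mul1r big_nat1.
  by rewrite (prod_neq_last 0) big_geq// divr1.
- rewrite /Nhat (integral_time_changed lambda_gt0 lambda_distinct distW indepW
    W_gt0 N_fin N_inf brownB indepNB t0).
  congr (_ + _)%E; apply: eq_eseriesr => k _.
  by rewrite sum_birth_state_coef.
- exact: (time_changed_total lambda_gt0 lambda_distinct lambda_series distW
    indepW W_gt0 N_fin N_inf brownB indepNB).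
Qed.
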